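(* Suppose $k$ is bounded and let $\widetilde\zeta=(\gamma,\tau):I\to M$ be a geodesic of $g$ with $\gamma(0)=x_0$, $\dot\gamma(0)=\widetilde X$ and $\dot\tau(0)=\widetilde Y\neq 0$. If $$g_1(\widetilde X,\widetilde X)>k(x_0)\,g_2(\widetilde Y,\widetilde Y)\,\frac{K_0-k(x_0)}{K_0},$$ then the curve $\widetilde\zeta$ is a Riemannian geodesic of $g$.
   Context: $(M_1,g_1)$ and $(M_2,g_2)$ are connected, complete Riemannian manifolds, and $k:M_1\to\mathbb R$ is a $C^\infty$ function with $k_0:=\inf_{x\in M_1}k(x)>0$. Put $M:=M_1\times M_2$ and let $g:=g_1-k\,g_2$ be the semi-Riemannian warped product metric on $M$. For $k$ bounded, put $K_0:=\sup_{x\in M_1}k(x)$ and $k_1:=-K_0^{-1}$. For $r>k_1$, $G_r:=(\frac1k+r)g_1$ is a Riemannian metric on $M_1$, and $G_r+g_2$ is the product Riemannian metric on $M$. $I:=[0,1]$. Riemannian geodesics of $g$: let $r>k_1$ and let $(\mu,\nu):I\to M$ be a geodesic of $G_r+g_2$. Let $\varphi:I\to I$ be the unique diffeomorphism with $\varphi(0)=0$, $\varphi(1)=1$, $\dot\varphi=a\left(\frac{1+rk}{k}\right)\circ\mu\circ\varphi$, where $a:=\int_0^1\frac{k(\mu(\xi))}{1+rk(\mu(\xi))}\,d\xi$, and put $\gamma:=\mu\circ\varphi$. Let $\psi:I\to I$ be the unique diffeomorphism with $\psi(0)=0$, $\psi(1)=1$, $\dot\psi=\frac{b}{k\circ\gamma}$,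 where $b:=\left(\int_0^1\frac{1}{k(\gamma(\xi))}\,d\xi\right)^{-1}$, and put $\tau:=\nu\circ\psi$. If the curve $(\gamma,\tau)$ is a geodesic of $g$, it is called a Riemannian geodesic of $g$ (obtained from $(\mu,\nu)$). A curve is a Riemannian geodesic of $g$ if it arises in this way for some $r>k_1$ and some $(\mu,\nu)$. *)

(* Defs.v *)
From mathcomp Require Import all_boot all_order all_algebra.
From mathcomp Require Import all_classical all_reals all_analysis.

Set Implicit Arguments.
Unset Strict Implicit.
Unset Printing Implicit Defensive.

Import Order.TTheory GRing.Theory Num.Theory.
Import numFieldNormedType.Exports.

Local Open Scope classical_set_scope.
Local Open Scope ring_scope.

(* C^m and C^oo maps on an open subset of R^n. *)

Fixpoint Ck (R : realType) (n : nat) (W : normedModType R) (m : nat)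
    (U : set 'rV[R]_n) (f : 'rV[R]_n -> W) : Prop :=
  match m with
  | 0%N => forall u, U u -> {for u, continuous f}
  | m'.+1 => (forall u, U u -> differentiable f u) /\
      forall i : 'I_n, Ck m' U (fun u => 'D_(delta_mx 0 i) f u)
  end.

Definition smooth_on (R : realType) (n : nat) (W : normedModType R)
    (U : set 'rV[R]_n) (f : 'rV[R]_n -> W) : Prop :=
  forall m, Ck m U f.

(* [coord c] is only meaningful on [cdom c], and [param c], the inverse chart,
   only on the image [coord c @` cdom c]; both are total functions. *)
Record atlas (R : realType) (n : nat) (M : topologicalType) := Atlas {
  chart : Type;
  cdom : chart -> set M;
  coord : chart -> M -> 'rV[R]_n;
  param : chart -> 'rV[R]_n -> M
}.

Section Manifold.
Context {R : realType} {n : nat} {M : topologicalType} (A : atlas R n M).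

Definition cimage (c : chart A) : set 'rV[R]_n := coord c @` cdom c.

Record smooth_manifold : Prop := SmoothManifold {
  mfd_hausdorff : hausdorff_space M;
  mfd_second_countable : @second_countable M;
  mfd_dom_open : forall c : chart A, open (cdom c);
  mfd_image_open : forall c : chart A, open (cimage c);
  mfd_coord_continuous : forall (c : chart A) p,
    cdom c p -> {for p, continuous (coord c)};
  mfd_param_continuous : forall (c : chart A) u,
    cimage c u -> {for u, continuous (param c)};
  mfd_coordK : forall (c : chart A) p, cdom c p -> param c (coord c p) = p;
  mfd_cover : forall p, exists c : chart A, cdom c p;
  mfd_transition : forall c c' : chart A,
    smooth_on (cimage c `&` param c @^-1` cdom c') (coord c' \o param c)
}.

Definition smooth_function (k : M -> R) : Prop :=
  forall c : chart A, smooth_on (cimage c) (k \o param c).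

(* A field of bilinear forms, given by its matrix of components at each point
   in each chart: the entry (i, j) of [g c p] is g_p(d/dx_i, d/dx_j) for the
   coordinates of [c]. Only points [p] of [cdom c] matter. *)
Definition metric := chart A -> M -> 'M[R]_n.

(* g_p(X, Y) for the tangent vectors at p with components v and w in c. *)
Definition metric_at (g : metric) (c : chart A) (p : M) (v w : 'rV[R]_n) : R :=
  (v *m g c p *m w^T) 0 0.

Record riemannian (g : metric) : Prop := Riemannian {
  riem_sym : forall c p, cdom c p -> (g c p)^T = g c p;
  riem_pos : forall c p v, cdom c p -> v != 0 -> 0 < metric_at g c p v v;
  riem_smooth : forall c i j,
    smooth_on (cimage c) (fun u => g c (param c u) i j);
  riem_tensor : forall c c' p v w, cdom c p -> cdom c' p ->
    let J := 'd (coord c' \o param c) (coord c p) in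
    metric_at g c p v w = metric_at g c' p (J v) (J w)
}.

(* Christoffel symbol Gamma^k_(i j) of g at p in the chart c. *)
Definition christoffel (g : metric) (c : chart A) (p : M) (k i j : 'I_n) : R :=
  let dg a b d :=
    'D_(delta_mx 0 a) (fun u => g c (param c u) b d) (coord c p) in
  2^-1 * \sum_l invmx (g c p) k l * (dg i j l + dg j i l - dg l i j).

(* To be used on an open set J of times. *)
Definition smooth_curve (J : set R) (s : R -> M) : Prop :=
  forall t, J t -> {for t, continuous s} /\
    forall c : chart A, cdom c (s t) ->
      forall m, derivable (derive1n m (coord c \o s)) t 1.

Definition geodesic_eq (g : metric) (s : R -> M) (t : R) : Prop :=
  forall c : chart A, cdom c (s t) -> forall k : 'I_n,
    let x := coord c \o s in
    derive1n 2 x t 0 k +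
      \sum_i \sum_j
        christoffel g c (s t) k i j * derive1 x t 0 i * derive1 x t 0 j = 0.

(* s is a geodesic of g on the interval J (open or not). As usual, smoothness
   on an interval that contains an end point means that there is a smooth
   extension to an open interval; derivatives are those of the extension. Only
   the restriction of s to J matters. *)
Definition geodesic (g : metric) (J : set R) (s : R -> M) : Prop :=
  exists (J' : set R) (s' : R -> M),
    [/\ open J', is_interval J', J `<=` J', smooth_curve J' s' &
        forall t, J t -> s' t = s t /\ geodesic_eq g s' t].

Definition complete_metric (g : metric) : Prop :=
  forall (J : set R) (s : R -> M), open J -> is_interval J -> geodesic g J s ->
    exists s' : R -> M, geodesic g setT s' /\ forall t, J t -> s' t = s t.

End Manifold.

(* f has derivative l at t as a function on J (one-sided at end points). *)
Definition derivative_within (R : realType) (W : normedModType R)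
    (J : set R) (f : R -> W) (t : R) (l : W) : Prop :=
  h^-1 *: (f (t + h) - f t) @[h --> within [set h | J (t + h)] (0 : R)^'] --> l.

Definition smooth_on_interval (R : realType) (J : set R) (f : R -> R) : Prop :=
  exists (J' : set R) (f' : R -> R),
    [/\ open J', is_interval J', J `<=` J',
        forall t, J' t -> forall m, derivable (derive1n m f') t 1 &
        forall t, J t -> f' t = f t].

Definition diffeomorphism (R : realType) (J : set R) (f : R -> R) : Prop :=
  smooth_on_interval J f /\ exists f' : R -> R,
    [/\ smooth_on_interval J f', forall t, J t -> J (f t),
        forall t, J t -> J (f' t), forall t, J t -> f' (f t) = t &
        forall t, J t -> f (f' t) = t].

Section Product.
Context {R : realType} {n1 n2 : nat} {M1 M2 : topologicalType}.
Variables (A1 : atlas R n1 M1) (A2 : atlas R n2 M2).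

Definition prod_atlas : atlas R (n1 + n2) (M1 * M2)%type :=
  {| chart := (chart A1 * chart A2)%type;
     cdom := fun c => cdom c.1 `*` cdom c.2;
     coord := fun c p => row_mx (coord c.1 p.1) (coord c.2 p.2);
     param := fun c u => (param c.1 (lsubmx u), param c.2 (rsubmx u)) |}.

(* g1 + g2 *)
Definition prod_metric (g1 : metric A1) (g2 : metric A2) : metric prod_atlas :=
  fun c p => block_mx (g1 c.1 p.1) 0 0 (g2 c.2 p.2).

(* g1 - k g2 *)
Definition warped_metric (g1 : metric A1) (k : M1 -> R) (g2 : metric A2) :
    metric prod_atlas :=
  fun c p => block_mx (g1 c.1 p.1) 0 0 (- k p.1 *: g2 c.2 p.2).

End Product.

(* G_r = (1/k + r) g1 *)
Definition conformal_metric (R : realType) (n : nat) (M : topologicalType)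
    (A : atlas R n M) (g1 : metric A) (k : M -> R) (r : R) : metric A :=
  fun c p => ((k p)^-1 + r) *: g1 c p.

Definition unit_itv {R : realType} : set R := [set` `[0, 1]%R].

Section RiemannianGeodesic.
Context {R : realType} {n1 n2 : nat} {M1 M2 : topologicalType}.
Variables (A1 : atlas R n1 M1) (A2 : atlas R n2 M2).
Variables (g1 : metric A1) (g2 : metric A2) (k : M1 -> R).

Local Notation I := unit_itv.

(* (gamma, tau) is obtained from (mu, nu) by the reparametrizations phi and
   psi, which are uniquely determined by these conditions. *)
Definition reparametrized_from (r : R) (mu : R -> M1) (nu : R -> M2)
    (gamma : R -> M1) (tau : R -> M2) : Prop :=
  let a :=
    \int[lebesgue_measure]_(xi in I) (k (mu xi) / (1 + r * k (mu xi))) in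
  let b := (\int[lebesgue_measure]_(xi in I) (k (gamma xi))^-1)^-1 in
  exists phi psi : R -> R,
    [/\ diffeomorphism I phi, phi 0 = 0, phi 1 = 1,
        forall t, I t -> derivative_within I phi t
          (a * ((1 + r * k (mu (phi t))) / k (mu (phi t)))) &
        forall t, I t -> gamma t = mu (phi t)] /\
    [/\ diffeomorphism I psi, psi 0 = 0, psi 1 = 1,
        forall t, I t -> derivative_within I psi t (b / k (gamma t)) &
        forall t, I t -> tau t = nu (psi t)].

Definition riemannian_geodesic (gamma : R -> M1) (tau : R -> M2) : Prop :=
  exists (r : R) (mu : R -> M1) (nu : R -> M2),
    [/\ - (sup (range k))^-1 < r,
        geodesic (prod_metric (conformal_metric g1 k r) g2) I
          (fun t => (mu t, nu t)),
        reparametrized_from r mu nu gamma tau &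
        geodesic (warped_metric g1 k g2) I (fun t => (gamma t, tau t))].

End RiemannianGeodesic.

Definition has_velocity (R : realType) (n : nat) (M : topologicalType)
    (A : atlas R n M) (s : R -> M) (t : R) (c : chart A) (v : 'rV[R]_n) : Prop :=
  cdom c (s t) /\ derivative_within unit_itv (coord c \o s) t v.

(* Main.v *)
From mathcomp Require Import all_boot all_order all_algebra.
From mathcomp Require Import all_classical all_reals all_analysis.
From mathcomp Require Import ring lra.
Require Import Defs.

(** Along a geodesic (gamma, tau) of g = g1 - k g2, two quantities are constant:
    the squared momentum C = k^2 g2(tau', tau') of the fibre and the energy
    E = g1(gamma', gamma') - k g2(tau', tau'). Hence
    g1(gamma', gamma') = C (1/k + r) with r = E / C, and the equation of gamma is
    that of a particle in the potential - C / (2 k). By Maupertuis' principle, gamma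
    is then a reparametrized geodesic of the Jacobi metric (1/k + r) g1, while tau is
    a reparametrized geodesic of g2. The hypothesis on the initial velocities is
    precisely E / C > - 1 / sup k, which makes 1/k + r positive everywhere.

    The changes of parameter are forced: phi' is proportional to 1/k + r and psi' to
    1/k along gamma. So phi and psi are normalized primitives of these functions,
    and mu = gamma o phi^-1, nu = tau o psi^-1. The constants a and b
    of the statement are the normalizing factors, because the integrands are
    derivatives of phi^-1 and psi up to these factors ([normalized_primitive]).

    Geodesic equations are handled with the index lowered ([lowered_acc]). In this
    form the equation for a warped metric splits into the two factors
    ([geodesic_eq_warped]), and the effects of a conformal change
    ([lowered_acc_scale]) and of a change of parameter ([lowered_acc_reparam]) are
    explicit, so that Maupertuis' principle ([geodesic_eq_jacobi]) becomes an
    algebraic identity. The first integrals follow from metric compatibility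
    ([is_derive_sq_speed]). *)

Set Implicit Arguments.
Unset Strict Implicit.
Unset Printing Implicit Defensive.

Import Order.TTheory GRing.Theory Num.Theory.
Import numFieldNormedType.Exports.

Local Open Scope classical_set_scope.
Local Open Scope ring_scope.

(** * Functions of one variable and their derivatives *)

Section OneVariable.
Context {R : realType}.
Implicit Types (W : normedModType R) (J K : set R) (m : nat).

(** The recursion goes through the derivative, so that the closure properties
    below are proved by induction on [m] with [f] generalized. *)
Fixpoint mderivable W m J (f : R -> W) : Prop :=
  if m is m'.+1 then
    (forall t, J t -> derivable f t 1) /\ mderivable m' J (derive1 f)
  else True.

Lemma mderivableP W J (f : R -> W) :
  (forall m, mderivable m J f) <->
  forall t, J t -> forall m, derivable (derive1n m f) t 1.
Proof.
split=> [fJ t Jt m|fJ m].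
  elim: m f fJ => [|m IH] f fJ; first by have [/(_ t Jt)] := fJ 1%N.
  by rewrite derive1Sn; apply: IH => k; have [] := fJ k.+1.
elim: m f fJ => [//|m IH] f fJ; split=> [t Jt|]; first exact: (fJ t Jt 0%N).
by apply: IH => t Jt k; rewrite -derive1Sn; exact: fJ.
Qed.

Lemma mderivableS W m J (f : R -> W) : mderivable m.+1 J f -> mderivable m J f.
Proof. by elim: m f => [//|m IH] f [df /IH]. Qed.

Lemma sub_mderivable W m J K (f : R -> W) :
  J `<=` K -> mderivable m K f -> mderivable m J f.
Proof.
by move=> JK; elim: m f => [//|m IH] f [df /IH]; split=> // t /JK; exact: df.
Qed.

Lemma open_near J t (P : R -> Prop) : open J -> J t ->
  (forall s, J s -> P s) -> \near t, P t.
Proof. by move=> oJ Jt JP; apply: filterS JP _; exact: open_nbhs_nbhs. Qed.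

Lemma eq_derive1_on W J (f g : R -> W) t : open J -> J t ->
  (forall s, J s -> f s = g s) -> derive1 f t = derive1 g t.
Proof.
move=> oJ Jt fg; rewrite !derive1E; apply: near_eq_derive.
exact: open_near oJ Jt fg.
Qed.

Lemma eq_mderivable W m J (f g : R -> W) : open J ->
  (forall t, J t -> f t = g t) -> mderivable m J f -> mderivable m J g.
Proof.
move=> oJ; elim: m f g => [//|m IH] f g fg [df f'm]; split=> [t Jt|].
  exact: near_eq_derivable (open_near oJ Jt fg) (df t Jt).
by apply: IH f'm => t Jt; exact: eq_derive1_on oJ Jt fg.
Qed.

Lemma mderivable_local W m J (f : R -> W) :
  (forall t, J t -> exists K, K t /\ mderivable m K f) -> mderivable m J f.
Proof.
elim: m f => [//|m IH] f fJ; split=> [t /fJ[K [Kt [+ _]]]|]; first exact.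
by apply: IH => t /fJ[K [Kt []]]; exists K.
Qed.

Lemma mderivable_cst W m J (w : W) : mderivable m J (fun=> w).
Proof.
elim: m w => [//|m IH] w; split=> [t _|]; first exact: derivable_cst.
rewrite (_ : (derive1 (fun=> w)) = fun=> 0) //.
by apply/funext => t; rewrite derive1_cst.
Qed.

Lemma mderivableD W m J (f g : R -> W) : open J ->
  mderivable m J f -> mderivable m J g -> mderivable m J (fun t => f t + g t).
Proof.
move=> oJ; elim: m f g => [//|m IH] f g [df fm] [dg gm]; split=> [t Jt|].
  by apply: derivableD; [exact: df|exact: dg].
apply: eq_mderivable (IH _ _ fm gm) => // t Jt.
by rewrite !derive1E -deriveD //; [exact: df|exact: dg].
Qed.

Lemma mderivableM m J (f g : R -> R) : open J ->
  mderivable m J f -> mderivable m J g -> mderivable m J (fun t => f t * g t).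
Proof.
move=> oJ; elim: m f g => [//|m IH] f g fS gS.
have [[df fm] [dg gm]] := (fS, gS); split=> [t Jt|].
  by apply: derivableM; [exact: df|exact: dg].
apply: eq_mderivable (mderivableD oJ (IH _ _ (mderivableS fS) gm)
  (IH _ _ (mderivableS gS) fm)) => // t Jt.
by rewrite !derive1E (@deriveM _ _ f g) //; [exact: df|exact: dg].
Qed.

Lemma mderivable_sum n m J (f : 'I_n -> R -> R) : open J ->
  (forall i, mderivable m J (f i)) -> mderivable m J (fun t => \sum_i f i t).
Proof.
move=> oJ; elim: n f => [|n IH] f fJ.
  by under eq_fun do rewrite big_ord0; exact: mderivable_cst.
under eq_fun do rewrite big_ord_recl.
by apply: mderivableD => //; apply: IH.
Qed.

Lemma mderivable_comp m J K (f g : R -> R) : open K ->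
  (forall t, K t -> J (g t)) -> mderivable m J f -> mderivable m K g ->
  mderivable m K (f \o g).
Proof.
move=> oK KJ; elim: m f => [//|m IH] f [df fm] gS; have [dg gm] := gS.
split=> [t Kt|].
  apply/derivable1_diffP/differentiable_comp; apply/derivable1_diffP.
    exact: dg.
  exact/df/KJ.
apply: eq_mderivable (mderivableM oK (IH _ fm (mderivableS gS)) gm) => // t Kt.
by rewrite (@derive1_comp _ g f t (dg t Kt) (df _ (KJ t Kt))).
Qed.

Lemma mderivableV m J (f : R -> R) : open J -> (forall t, J t -> f t != 0) ->
  mderivable m J f -> mderivable m J (fun t => (f t)^-1).
Proof.
move=> oJ f0; elim: m f f0 => [//|m IH] f f0 fS; have [df fm] := fS.
split=> [t Jt|]; first by apply: derivableV; [exact: f0|exact: df].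
have V2 : mderivable m J (fun t => (f t)^-1 * (f t)^-1).
  by apply: mderivableM => //; apply: IH => //; exact: mderivableS.
have V' : mderivable m J (fun t => - 1 * ((f t)^-1 * (f t)^-1 * derive1 f t)).
  by apply: mderivableM => //; [exact: mderivable_cst|exact: mderivableM].
apply: eq_mderivable V' => // t Jt.
rewrite !derive1E (@deriveV _ _ f) //; [|exact: f0|exact: df].
by rewrite mulN1r scaleNr -exprVn expr2.
Qed.

Lemma derive1_coord n (x : R -> 'rV[R]_n) t i : derivable x t 1 ->
  derive1 x t 0 i = derive1 (fun s => x s 0 i) t.
Proof. by move=> dx; rewrite !derive1E derive_mx // mxE. Qed.

Lemma derivable_rVP n (x : R -> 'rV[R]_n) t :
  derivable x t 1 <-> forall i, derivable (fun s => x s 0 i) t 1.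
Proof.
rewrite derivable_mxP; split=> [dx i|dx i j]; first exact: dx.
by rewrite ord1.
Qed.

Lemma mderivable_rVP n m J (x : R -> 'rV[R]_n) : open J ->
  mderivable m J x <-> forall i, mderivable m J (fun t => x t 0 i).
Proof.
move=> oJ; elim: m x => [//|m IH] x /=.
split=> [[dx /IH xm] i|xJ].
  split=> [t /dx/derivable_rVP //|].
  apply: eq_mderivable (xm i) => // t Jt.
  by rewrite derive1_coord //; exact: dx.
have dx t : J t -> derivable x t 1.
  by move=> Jt; apply/derivable_rVP => i; exact: (xJ i).1.
split=> //; apply/IH => i; apply: eq_mderivable (xJ i).2 => // t Jt.
by rewrite derive1_coord //; exact: dx.
Qed.

Lemma is_derive_comp_rV n (f : 'rV[R]_n -> R) (x : R -> 'rV[R]_n) t :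
  differentiable f (x t) -> derivable x t 1 ->
  is_derive t 1 (f \o x) (\sum_i 'D_(delta_mx 0 i) f (x t) * derive1 x t 0 i).
Proof.
move=> df /derivable1_diffP dx.
have dfx : differentiable (f \o x) t by exact: differentiable_comp.
apply: DeriveDef; first exact: diff_derivable.
rewrite deriveE // diff_comp //= -derive1E' // {1}(row_sum_delta (derive1 x t)).
rewrite linear_sum; apply: eq_bigr => i _.
by rewrite linearZ /= deriveE // mulrC.
Qed.

(** By induction on the order: the chain rule writes the derivative of [f \o x]
    through partial derivatives of [f], which have one degree of smoothness less
    and are again composed with [x]. *)
Lemma mderivable_comp_rV n m J (U : set 'rV[R]_n) (f : 'rV[R]_n -> R)
    (x : R -> 'rV[R]_n) : open J -> (forall t, J t -> U (x t)) ->
  Ck m U f -> mderivable m J x -> mderivable m J (f \o x).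
Proof.
move=> oJ JU; elim: m f => [//|m IH] f [df fm] xS; have [dx xm] := xS.
have D t : J t -> is_derive t 1 (f \o x)
    (\sum_i 'D_(delta_mx 0 i) f (x t) * derive1 x t 0 i).
  by move=> Jt; apply: is_derive_comp_rV; [exact/df/JU|exact: dx].
split=> [t /D[]//|].
apply: (@eq_mderivable _ _ _
  (fun t => \sum_i 'D_(delta_mx 0 i) f (x t) * derive1 x t 0 i)) => //.
  by move=> t /D[_ <-]; rewrite derive1E.
apply: mderivable_sum => // i; apply: mderivableM => //.
  exact: IH (fm i) (mderivableS xS).
exact/(mderivable_rVP m _ oJ).1.
Qed.

End OneVariable.

Section Reparametrization.
Context {R : realType}.

Lemma continuous_antiderivative (f : R -> R) (a b : R) :
  (forall t, t \in `[a, b] -> {for t, continuous f}) ->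
  exists F : R -> R, forall t, t \in `]a, b[ -> is_derive t 1 F (f t).
Proof.
move=> cf; exists (fun x => \int[lebesgue_measure]_(t in `[a, x]) f t) => t tab.
have /andP[at_ tb] := tab.
have fI : lebesgue_measure.-integrable `[a, b] (EFin \o f).
  apply: continuous_compact_integrable; first exact: segment_compact.
  apply: continuous_in_subspaceT => x; rewrite inE => xab. exact: cf.
have ct : {for t, continuous f} by exact/cf/subset_itv_oo_cc.
have [] := continuous_FTC1_closed tb fI at_ ct.
by move=> dF <-; rewrite derive1E; exact: derivableP.
Qed.

(** The inverse satisfies g' = 1 / f'(g), so each degree of smoothness of [g] on
    the right-hand side gives one more on the left. The interval is shrunk to
    ]a, b[ inside [J] so that the image is an explicit interval. *)
Lemma smooth_inverse (J : set R) (f : R -> R) (a b : R) : open J ->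
  `[a, b] `<=` J -> (forall m, mderivable m J f) ->
  (forall t, J t -> 0 < derive1 f t) ->
  a < b -> let K : set R := `]f a, f b[%classic in
  exists g : R -> R,
    [/\ forall y, K y -> (g y \in `]a, b[) /\ f (g y) = y,
        forall t, t \in `]a, b[ -> K (f t) /\ g (f t) = t,
        forall y, K y -> is_derive y 1 g (derive1 f (g y))^-1 &
        forall m, mderivable m K g].
Proof.
move=> oJ abJ fS f'0 ab K.
have df t : J t -> derivable f t 1 by have [+ _] := fS 1%N; exact.
have cf t : J t -> {for t, continuous f}.
  by move=> /df/derivable1_diffP/differentiable_continuous.
have cfab : {within `[a, b], continuous f}.
  by apply: continuous_in_subspaceT => x; rewrite inE => /abJ Jx; exact: cf.
have sab t : t \in `]a, b[ -> J t by move=> /subset_itv_oo_cc/abJ.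
have flt : {in `[a, b] &, {homo f : x y / x < y}}.
  by apply: gtr0_derive1_lt_cc => // x /sab; [exact: df|exact: f'0].
have fle : {in `[a, b] &, {mono f : x y / x <= y}} by exact: le_mono_in.
have finj : {in `[a, b] &, injective f} by exact: inc_inj_in.
have aab : a \in `[a, b] by rewrite in_itv /= lexx ltW.
have bab : b \in `[a, b] by rewrite in_itv /= lexx ltW.
pose P y : set R := fun t => (t \in `]a, b[) /\ f t = y.
pose g y := xget 0 (P y).
have gK y : K y -> (g y \in `]a, b[) /\ f (g y) = y.
  rewrite /K /= in_itv /= => /andP[ay yb].
  apply: (@xgetPex _ 0 (P y)).
  have [|c cab fc] := @IVT _ f a b y (ltW ab) cfab.
    by rewrite ge_min le_max (ltW ay) (ltW yb) orbT.
  exists c; split=> //; move: cab ay yb; rewrite -fc !in_itv /= => /andP[ac cb].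
  rewrite !lt_neqAle ac cb !andbT => /andP[fac _] /andP[fcb _].
  apply/andP; split; first by apply: contraNneq fac => ->.
  by apply: contraNneq fcb => ->.
have Kf t : t \in `]a, b[ -> K (f t).
  move=> tab; have tab' := subset_itv_oo_cc tab.
  by move: (tab); rewrite /K /= !in_itv /= => /andP[? ?]; rewrite !flt.
have fK t : t \in `]a, b[ -> g (f t) = t.
  move=> tab; have [gab fg] := gK _ (Kf t tab).
  by apply: finj => //; exact: subset_itv_oo_cc.
have oab : open `]a, b[%classic by exact: interval_open.
have dg y : K y -> is_derive y 1 g (derive1 f (g y))^-1.
  move=> Ky; have [gab fg] := gK y Ky; have Jg := sab _ gab.
  rewrite -{1}fg; apply: is_derive_inverse; last by rewrite gt_eqF ?f'0.
  - by apply: (open_near oab gab) => t /fK.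
  - by apply: (open_near oab gab) => t /sab; exact: cf.
  - by rewrite derive1E; apply: derivableP; exact: df.
exists g; split=> //; first by move=> t tab; split; [exact: Kf|exact: fK].
have oK : open K by exact: interval_open.
elim=> [//|m IH]; split=> [y Ky|]; first by have [] := dg y Ky.
have gJ y : K y -> J (g y) by move=> /gK[/sab].
have f'm : mderivable m J (derive1 f) by have [] := fS m.+1.
apply: eq_mderivable (mderivableV oK _ (mderivable_comp oK gJ f'm IH)) => // y Ky.
  by have [_ <-] := dg y Ky; rewrite derive1E.
by rewrite /= gt_eqF // f'0 //; exact: gJ.
Qed.

End Reparametrization.

(** * Geodesic equations with a lowered index *)

Section LoweredAcceleration.
Context {R : realType} {n : nat} {M : topologicalType} {A : atlas R n M}.
Implicit Types (g : metric A) (c : chart A) (p : M) (v w : 'rV[R]_n).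

Definition partial (f : M -> R) c p (a : 'I_n) : R :=
  'D_(delta_mx 0 a) (f \o param c) (coord c p).

Definition dmetric g c p (a i j : 'I_n) : R :=
  partial (fun q => g c q i j) c p a.

(** The covariant acceleration of a curve with velocity [v] and second derivative
    [w] in the chart [c], with its index lowered by [g]. This is the
    Euler-Lagrange expression of the kinetic energy g(v, v) / 2; it involves
    neither the inverse matrix of [g] nor Christoffel symbols. *)
Definition lowered_acc g c p v w (m : 'I_n) : R :=
  (w *m g c p) 0 m
  + \sum_i \sum_j dmetric g c p i j m * v 0 i * v 0 j
  - 2^-1 * \sum_i \sum_j dmetric g c p m i j * v 0 i * v 0 j.

Lemma metric_atE g c p v w :
  metric_at g c p v w = \sum_i \sum_j v 0 i * g c p i j * w 0 j.
Proof.
rewrite /metric_at mxE exchange_big; apply: eq_bigr => j _.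
by rewrite mxE mulr_suml; apply: eq_bigr => i _; rewrite mxE.
Qed.

Lemma metric_at_sum g c p v w :
  metric_at g c p v w = \sum_m (v *m g c p) 0 m * w 0 m.
Proof. by rewrite /metric_at mxE; apply: eq_bigr => j _; rewrite [w^T _ _]mxE. Qed.

(** Lowering the index is invertible, and in the sum against [v 0 i * v 0 j] the
    first two of the three terms of a Christoffel symbol coincide. *)
Lemma lowered_acc_eq0 g c p v w : (g c p)^T = g c p -> g c p \in unitmx ->
  (forall k, w 0 k + \sum_i \sum_j
     christoffel g c p k i j * v 0 i * v 0 j = 0) <->
  forall m, lowered_acc g c p v w m = 0.
Proof.
move=> gT gU; pose L := \row_m (\sum_i \sum_j dmetric g c p i j m * v 0 i * v 0 j
  - 2^-1 * \sum_i \sum_j dmetric g c p m i j * v 0 i * v 0 j).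
have LE k : \sum_i \sum_j christoffel g c p k i j * v 0 i * v 0 j
    = (L *m invmx (g c p)) 0 k.
  rewrite mxE /christoffel.
  pose S l := \sum_i \sum_j 2^-1 * (dmetric g c p i j l + dmetric g c p j i l
    - dmetric g c p l i j) * v 0 i * v 0 j.
  have -> : \sum_j L 0 j * invmx (g c p) j k = \sum_l S l * invmx (g c p) k l.
    apply: eq_bigr => l _; congr (_ * _); last first.
      by rewrite -[in RHS]gT -trmx_inv mxE.
    rewrite mxE; set D := dmetric g c p.
    transitivity (2^-1 * (\sum_i \sum_j D i j l * v 0 i * v 0 j)
      + 2^-1 * (\sum_i \sum_j D j i l * v 0 i * v 0 j)
      - 2^-1 * (\sum_i \sum_j D l i j * v 0 i * v 0 j)).
      have -> : \sum_i \sum_j D j i l * v 0 i * v 0 j =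
          \sum_i \sum_j D i j l * v 0 i * v 0 j.
        rewrite exchange_big; apply: eq_bigr => i _; apply: eq_bigr => j _.
        by rewrite mulrAC.
      by congr (_ - _); field.
    rewrite !mulr_sumr -sumrN -!big_split; apply: eq_bigr => i _ /=.
    rewrite !mulr_sumr -sumrN -!big_split; apply: eq_bigr => j _ /=.
    by rewrite /D; ring.
  under eq_bigr do under eq_bigr do rewrite mulr_sumr !mulr_suml.
  under eq_bigr do rewrite exchange_big.
  rewrite exchange_big; apply: eq_bigr => l _; rewrite /S mulr_suml.
  apply: eq_bigr => i _; rewrite mulr_suml; apply: eq_bigr => j _.
  by rewrite /dmetric /partial /=; ring.
have accE m : lowered_acc g c p v w m = (w *m g c p + L) 0 m.
  by rewrite /lowered_acc [RHS]mxE [L _ _]mxE addrA.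
split=> [geo m|acc k].
  have wE : w = - (L *m invmx (g c p)).
    apply/rowP => k; rewrite [RHS]mxE -LE; apply/eqP.
    by rewrite -addr_eq0 geo.
  by rewrite accE wE mulNmx mulmxKV // addNr mxE.
have : w *m g c p = - L.
  apply/rowP => m; rewrite [RHS]mxE; apply/eqP; rewrite -addr_eq0.
  by have := acc m; rewrite accE mxE => ->.
move=> wg; rewrite LE -{1}[w](mulmxK gU) wg mulNmx.
by rewrite [X in X + _]mxE addNr.
Qed.

(** The effect of a change of parameter with first derivative [a] and second
    derivative [b]: the tangential term is the only one that does not scale. *)
Lemma lowered_acc_reparam g c p (a b : R) v w m :
  lowered_acc g c p (a *: v) (b *: v + a ^+ 2 *: w) m =
  a ^+ 2 * lowered_acc g c p v w m + b * (v *m g c p) 0 m.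
Proof.
have pE : ((b *: v + a ^+ 2 *: w) *m g c p) 0 m =
    b * (v *m g c p) 0 m + a ^+ 2 * (w *m g c p) 0 m.
  by rewrite mulmxDl -!scalemxAl mxE; congr (_ + _); rewrite mxE.
have DE (D : 'I_n -> 'I_n -> R) :
    \sum_i \sum_j D i j * (a *: v) 0 i * (a *: v) 0 j =
    a ^+ 2 * \sum_i \sum_j D i j * v 0 i * v 0 j.
  rewrite mulr_sumr; apply: eq_bigr => i _; rewrite mulr_sumr.
  by apply: eq_bigr => j _; rewrite !mxE; ring.
by rewrite /lowered_acc pE !DE; ring.
Qed.

(** The derivative of the conformal factor [f] contributes a tangential term, from
    the variation of [f] along the curve, and a gradient term proportional to
    g(v, v). *)
Lemma lowered_acc_scale (f : M -> R) g c p v w m : cdom c p ->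
  param c (coord c p) = p ->
  (forall a, derivable (f \o param c) (coord c p) (delta_mx 0 a)) ->
  (forall i j a, derivable (fun u => g c (param c u) i j) (coord c p)
     (delta_mx 0 a)) ->
  lowered_acc (fun c p => f p *: g c p) c p v w m =
  f p * lowered_acc g c p v w m
  + (\sum_a partial f c p a * v 0 a) * (v *m g c p) 0 m
  - 2^-1 * partial f c p m * metric_at g c p v v.
Proof.
move=> cp pK df dg.
have dE a i j : dmetric (fun c p => f p *: g c p) c p a i j =
    partial f c p a * g c p i j + f p * dmetric g c p a i j.
  rewrite /dmetric {1}/partial.
  rewrite (_ : _ \o _ = (f \o param c) * (fun u => g c (param c u) i j)).
    rewrite (deriveM (df a) (dg i j a)) addrC /= pK.
    by congr (_ + _); exact: mulrC.
  by apply/funext => u /=; rewrite mxE.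
have sumE a : \sum_i \sum_j dmetric (fun c p => f p *: g c p) c p i j a
     * v 0 i * v 0 j =
   (\sum_i partial f c p i * v 0 i) * (v *m g c p) 0 a +
   f p * \sum_i \sum_j dmetric g c p i j a * v 0 i * v 0 j.
  rewrite mulr_suml mulr_sumr -big_split; apply: eq_bigr => i _ /=.
  rewrite mxE !mulr_sumr -big_split; apply: eq_bigr => j _ /=.
  by rewrite dE; ring.
have pE : (w *m (f p *: g c p)) 0 m = f p * (w *m g c p) 0 m.
  by rewrite -scalemxAr mxE.
rewrite /lowered_acc sumE pE metric_atE.
have -> : \sum_i \sum_j dmetric (fun c p => f p *: g c p) c p m i j
     * v 0 i * v 0 j =
   partial f c p m * (\sum_i \sum_j v 0 i * g c p i j * v 0 j) +
   f p * \sum_i \sum_j dmetric g c p m i j * v 0 i * v 0 j.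
  rewrite !mulr_sumr -big_split; apply: eq_bigr => i _ /=.
  rewrite !mulr_sumr -big_split; apply: eq_bigr => j _ /=.
  by rewrite dE; ring.
by ring.
Qed.

End LoweredAcceleration.

Lemma eq_derive {R : realType} {V W : normedModType R} (f h : V -> W) a v :
  f =1 h -> 'D_v f a = 'D_v h a.
Proof. by move/funext ->. Qed.

Section WarpedProduct.
Context {R : realType} {n1 n2 : nat} {M1 M2 : topologicalType}.
Context {A1 : atlas R n1 M1} {A2 : atlas R n2 M2}.

(** A partial derivative in a product chart along a coordinate of one factor only
    sees the restriction of the function to that factor. *)
Lemma derive_row_mxl (W : normedModType R)
    (F : 'rV[R]_(n1 + n2) -> W) (a : 'rV[R]_n1) (b : 'rV[R]_n2) i :
  'D_(delta_mx 0 (lshift n2 i)) F (row_mx a b) =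
  'D_(delta_mx 0 i) (fun u => F (row_mx u b)) a.
Proof.
rewrite /derive; set f := (fun h => _); set f' := (fun h => _).
suff -> : f = f' by []; apply/funext => h; rewrite /f /f' /=.
by rewrite delta_mx_lshift scale_row_mx add_row_mx scaler0 add0r.
Qed.

Lemma derive_row_mxr (W : normedModType R)
    (F : 'rV[R]_(n1 + n2) -> W) (a : 'rV[R]_n1) (b : 'rV[R]_n2) i :
  'D_(delta_mx 0 (rshift n1 i)) F (row_mx a b) =
  'D_(delta_mx 0 i) (fun u => F (row_mx a u)) b.
Proof.
rewrite /derive; set f := (fun h => _); set f' := (fun h => _).
suff -> : f = f' by []; apply/funext => h; rewrite /f /f' /=.
by rewrite delta_mx_rshift scale_row_mx add_row_mx scaler0 add0r.
Qed.

Section AtPoint.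
Variables (g1 : metric A1) (g2 : metric A2) (k : M1 -> R).
Variables (c1 : chart A1) (c2 : chart A2) (p1 : M1) (p2 : M2).
Hypotheses (pK1 : param c1 (coord c1 p1) = p1)
  (pK2 : param c2 (coord c2 p2) = p2).
Hypothesis dk : forall a, derivable (k \o param c1) (coord c1 p1) (delta_mx 0 a).
Hypothesis dg2 : forall i j a,
  derivable (fun u => g2 c2 (param c2 u) i j) (coord c2 p2) (delta_mx 0 a).

Local Notation w := (warped_metric g1 k g2).
Local Notation c := ((c1, c2) : chart (prod_atlas A1 A2)).
Local Notation p := (p1, p2).

(* The partial derivatives of the blocks of the warped metric. In the names, the
   three letters tell the factor of the direction and of the two indices; x
   stands for an arbitrary direction. *)
Let dw_l i a b : dmetric w c p (lshift n2 i) a b = 'D_(delta_mx 0 i)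
  (fun u => w c (param c1 u, p2) a b) (coord c1 p1).
Proof.
apply: etrans (derive_row_mxl (fun u => w c (param c u) a b) _ _ i) _.
by apply: eq_derive => u /=; rewrite row_mxKl row_mxKr pK2.
Qed.

Let dw_r i a b : dmetric w c p (rshift n1 i) a b = 'D_(delta_mx 0 i)
  (fun u => w c (p1, param c2 u) a b) (coord c2 p2).
Proof.
apply: etrans (derive_row_mxr (fun u => w c (param c u) a b) _ _ i) _.
by apply: eq_derive => u /=; rewrite row_mxKl row_mxKr pK1.
Qed.

Let dw_lll i a b : dmetric w c p (lshift n2 i) (lshift n2 a) (lshift n2 b) =
  dmetric g1 c1 p1 i a b.
Proof.
rewrite dw_l; by apply: eq_derive => u /=; rewrite block_mxEul.
Qed.

Let dw_rll i a b : dmetric w c p (rshift n1 i) (lshift n2 a) (lshift n2 b) = 0.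
Proof.
rewrite dw_r -[RHS](derive_cst (g1 c1 p1 a b) (coord c2 p2) (delta_mx 0 i)).
by apply: eq_derive => u /=; rewrite block_mxEul.
Qed.

Let dw_xlr i a b : dmetric w c p i (lshift n2 a) (rshift n1 b) = 0.
Proof.
rewrite /dmetric /partial -[RHS](derive_cst 0 (coord c p) (delta_mx 0 i)).
by apply: eq_derive => u /=; rewrite block_mxEur mxE.
Qed.

Let dw_xrl i a b : dmetric w c p i (rshift n1 a) (lshift n2 b) = 0.
Proof.
rewrite /dmetric /partial -[RHS](derive_cst 0 (coord c p) (delta_mx 0 i)).
by apply: eq_derive => u /=; rewrite block_mxEdl mxE.
Qed.

Let dw_lrr i a b : dmetric w c p (lshift n2 i) (rshift n1 a) (rshift n1 b) =
  - (partial k c1 p1 i * g2 c2 p2 a b).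
Proof.
rewrite dw_l.
transitivity ('D_(delta_mx 0 i) ((- g2 c2 p2 a b) \*: (k \o param c1)) (coord c1 p1)).
  apply: eq_derive => u /=.
  by rewrite block_mxEdr mxE mulNr mulrC -mulNr.
by rewrite deriveZ // /partial scaleNr mulrC.
Qed.

Let dw_rrr i a b : dmetric w c p (rshift n1 i) (rshift n1 a) (rshift n1 b) =
  - (k p1 * dmetric g2 c2 p2 i a b).
Proof.
rewrite dw_r.
transitivity ('D_(delta_mx 0 i) ((- k p1) \*: (fun u => g2 c2 (param c2 u) a b))
   (coord c2 p2)).
  by apply: eq_derive => u /=; rewrite block_mxEdr mxE.
by rewrite deriveZ // /dmetric /partial scaleNr.
Qed.

Variables (v1 w1 : 'rV[R]_n1) (v2 w2 : 'rV[R]_n2).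

(** The factor of the base: the warping function acts as a potential, weighted by
    the squared speed of the other factor. *)
Lemma lowered_acc_warpedl m :
  lowered_acc w c p (row_mx v1 v2) (row_mx w1 w2) (lshift n2 m) =
  lowered_acc g1 c1 p1 v1 w1 m
  + 2^-1 * partial k c1 p1 m * metric_at g2 c2 p2 v2 v2.
Proof.
rewrite /lowered_acc mul_row_block !mulmx0 addr0 row_mxEl.
have -> : \sum_i \sum_j dmetric w c p i j (lshift n2 m) * row_mx v1 v2 0 i *
    row_mx v1 v2 0 j = \sum_i \sum_j dmetric g1 c1 p1 i j m * v1 0 i * v1 0 j.
  rewrite big_split_ord /= [X in _ + X]big1 ?addr0 => [|i _].
    apply: eq_bigr => i _; rewrite big_split_ord /= [X in _ + X]big1 ?addr0.
      by apply: eq_bigr => j _; rewrite !row_mxEl dw_lll.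
    by move=> j _; rewrite dw_xrl !mul0r.
  rewrite big_split_ord /= !big1 ?addr0 // => j _.
    by rewrite dw_xrl !mul0r.
  by rewrite dw_rll !mul0r.
have -> : \sum_i \sum_j dmetric w c p (lshift n2 m) i j * row_mx v1 v2 0 i *
    row_mx v1 v2 0 j = \sum_i \sum_j dmetric g1 c1 p1 m i j * v1 0 i * v1 0 j
    - partial k c1 p1 m * metric_at g2 c2 p2 v2 v2.
  rewrite big_split_ord /=; congr (_ + _).
    apply: eq_bigr => i _; rewrite big_split_ord /= [X in _ + X]big1 ?addr0.
      by apply: eq_bigr => j _; rewrite !row_mxEl dw_lll.
    by move=> j _; rewrite dw_xlr !mul0r.
  rewrite metric_atE mulr_sumr -sumrN; apply: eq_bigr => i _.
  rewrite big_split_ord /= [X in X + _]big1 ?add0r => [|j _].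
    rewrite mulr_sumr -sumrN; apply: eq_bigr => j _.
    by rewrite !row_mxEr dw_lrr; ring.
  by rewrite dw_xrl !mul0r.
by ring.
Qed.

(** The factor of the fibre: up to the sign and a factor, a geodesic equation with
    a friction term along the curve, hence a reparametrized geodesic. *)
Lemma lowered_acc_warpedr m :
  lowered_acc w c p (row_mx v1 v2) (row_mx w1 w2) (rshift n1 m) =
  - (k p1 * lowered_acc g2 c2 p2 v2 w2 m)
  - (\sum_a partial k c1 p1 a * v1 0 a) * (v2 *m g2 c2 p2) 0 m.
Proof.
have pE : (w2 *m (- k p1 *: g2 c2 p2)) 0 m = - k p1 * (w2 *m g2 c2 p2) 0 m.
  by rewrite -scalemxAr mxE.
rewrite /lowered_acc mul_row_block !mulmx0 add0r row_mxEr /= pE.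
have -> : \sum_i \sum_j dmetric w c p i j (rshift n1 m) * row_mx v1 v2 0 i *
    row_mx v1 v2 0 j =
    - ((\sum_a partial k c1 p1 a * v1 0 a) * (v2 *m g2 c2 p2) 0 m)
    - k p1 * \sum_i \sum_j dmetric g2 c2 p2 i j m * v2 0 i * v2 0 j.
  rewrite big_split_ord /=; congr (_ + _).
    rewrite mulr_suml -sumrN; apply: eq_bigr => i _; rewrite big_split_ord /=.
    rewrite [X in X + _]big1 ?add0r => [|j _].
      rewrite [(v2 *m _) _ _]mxE mulr_sumr -sumrN; apply: eq_bigr => j _.
      by rewrite row_mxEl row_mxEr dw_lrr; ring.
    by rewrite dw_xlr !mul0r.
  rewrite mulr_sumr -sumrN; apply: eq_bigr => i _; rewrite big_split_ord /=.
  rewrite [X in X + _]big1 ?add0r => [|j _].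
    rewrite mulr_sumr -sumrN; apply: eq_bigr => j _.
    by rewrite !row_mxEr dw_rrr; ring.
  by rewrite dw_xlr !mul0r.
have -> : \sum_i \sum_j dmetric w c p (rshift n1 m) i j * row_mx v1 v2 0 i *
    row_mx v1 v2 0 j =
    - (k p1 * \sum_i \sum_j dmetric g2 c2 p2 m i j * v2 0 i * v2 0 j).
  rewrite big_split_ord /= [X in X + _]big1 ?add0r => [|i _].
    rewrite mulr_sumr -sumrN; apply: eq_bigr => i _; rewrite big_split_ord /=.
    rewrite [X in X + _]big1 ?add0r => [|j _].
      rewrite mulr_sumr -sumrN; apply: eq_bigr => j _.
      by rewrite !row_mxEr dw_rrr; ring.
    by rewrite dw_xrl !mul0r.
  rewrite big_split_ord /= !big1 ?addr0 // => j _.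
    by rewrite dw_xlr !mul0r.
  by rewrite dw_rll !mul0r.
by ring.
Qed.

End AtPoint.
End WarpedProduct.

(** * Curves in a manifold *)

Section Curves.
Context {R : realType} {n : nat} {M : topologicalType} {A : atlas R n M}.
Hypothesis mfd : smooth_manifold A.
Implicit Types (g : metric A) (c : chart A) (p : M) (J : set R) (s : R -> M).

Definition velocity c s : R -> 'rV[R]_n := derive1 (coord c \o s).
Definition acceleration c s : R -> 'rV[R]_n := derive1 (velocity c s).

Definition in_chart J s c : set R := [set t | J t /\ cdom c (s t)].

Lemma smooth_curve_mderivable J s : smooth_curve A J s ->
  forall c m, mderivable m (in_chart J s c) (coord c \o s).
Proof.
by move=> sS c; apply/mderivableP => t [Jt ct] m; have [_] := sS t Jt; apply.
Qed.

Lemma mderivable_smooth_curve J s : (forall t, J t -> {for t, continuous s}) ->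
  (forall c m, mderivable m (in_chart J s c) (coord c \o s)) -> smooth_curve A J s.
Proof.
move=> sc sS t Jt; split=> [|c ct m]; first exact: sc.
exact: (mderivableP _ _).1 (sS c) t (conj Jt ct) m.
Qed.

Lemma open_in_chart J s c : open J -> (forall t, J t -> {for t, continuous s}) ->
  open (in_chart J s c).
Proof.
move=> oJ sc; rewrite openE => t [Jt ct]; apply: filterI.
  exact: open_nbhs_nbhs.
by apply: sc => //; apply: open_nbhs_nbhs; split=> //; exact: mfd_dom_open.
Qed.

Lemma smooth_function_diff (f : M -> R) c p :
  smooth_on (cimage c) (f \o param c) -> cdom c p ->
  differentiable (f \o param c) (coord c p).
Proof. by move=> fS cp; apply: (fS 1%N).1; exists p. Qed.

Section OneCurve.
Variables (J : set R) (s : R -> M).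
Hypotheses (oJ : open J) (sS : smooth_curve A J s).

Let sc t : J t -> {for t, continuous s}.
Proof. by move=> /sS[]. Qed.

Let oJc c : open (in_chart J s c).
Proof. exact: open_in_chart. Qed.

Lemma derivable_chart c t : J t -> cdom c (s t) -> derivable (coord c \o s) t 1.
Proof. by move=> Jt ct; apply: (smooth_curve_mderivable sS c 1).1. Qed.

Lemma derivable_velocity c t : J t -> cdom c (s t) ->
  derivable (velocity c s) t 1.
Proof. by move=> Jt ct; apply: (smooth_curve_mderivable sS c 2).2.1. Qed.

Lemma is_derive_along (f : M -> R) c t : J t -> cdom c (s t) ->
  differentiable (f \o param c) (coord c (s t)) ->
  is_derive t 1 (f \o s) (\sum_a partial f c (s t) a * velocity c s t 0 a).
Proof.
move=> Jt ct df; have Jct : in_chart J s c t by [].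
have E u : in_chart J s c u ->
    ((f \o param c) \o (coord c \o s)) u = (f \o s) u.
  by move=> [_ cu] /=; rewrite (mfd_coordK mfd).
exact: near_eq_is_derive (open_near (@oJc c) Jct E)
  (is_derive_comp_rV df (derivable_chart Jt ct)).
Qed.

(** Smoothness is local, so it can be checked in a chart around each point. *)
Lemma mderivable_along (f : M -> R) m : smooth_function A f -> mderivable m J (f \o s).
Proof.
move=> fS; apply: mderivable_local => t Jt; have [c ct] := mfd_cover mfd (s t).
exists (in_chart J s c); split=> //.
have sC := smooth_curve_mderivable sS c m.
apply: eq_mderivable (mderivable_comp_rV (@oJc c) _ (fS c m) sC) => //= u [_ cu].
  by rewrite /= (mfd_coordK mfd).
by exists (s u).
Qed.

Lemma velocity_change c c' t : J t -> cdom c (s t) -> cdom c' (s t) ->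
  velocity c' s t =
  'd (coord c' \o param c) (coord c (s t)) (velocity c s t).
Proof.
move=> Jt ct ct'; have Jct : in_chart J s c t by [].
have dT : differentiable (coord c' \o param c) (coord c (s t)).
  apply: (mfd_transition mfd c c' 1%N).1; split; first by exists (s t).
  by rewrite /= (mfd_coordK mfd).
have dx : differentiable (coord c \o s) t.
  exact/derivable1_diffP/derivable_chart.
rewrite /velocity [in RHS]derive1E' //.
rewrite -[RHS]/(('d (coord c' \o param c) (coord c (s t)) \o
   'd (coord c \o s) t) 1) -(@diff_comp _ _ _ _ (coord c \o s)) //.
rewrite -derive1E'; last exact: differentiable_comp.
apply: (eq_derive1_on (@oJc c) Jct) => u [_ cu] /=.
by rewrite (mfd_coordK mfd).
Qed.

(** g(s', s') computed in an arbitrary chart around [s t]; by [sq_speedE] the choice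
    does not matter, which gives a function of time defined across charts. *)
Definition sq_speed g t : R :=
  let c := projT1 (cid (mfd_cover mfd (s t))) in
  metric_at g c (s t) (velocity c s t) (velocity c s t).

Variable g : metric A.
Hypothesis riem : riemannian g.

Lemma sq_speedE c t : J t -> cdom c (s t) ->
  sq_speed g t = metric_at g c (s t) (velocity c s t) (velocity c s t).
Proof.
rewrite /sq_speed; case: cid => c' /= c't Jt ct.
by rewrite (riem_tensor riem _ _ c't ct) /= -velocity_change.
Qed.

Lemma metric_diff c p i j : cdom c p ->
  differentiable (fun u => g c (param c u) i j) (coord c p).
Proof.
exact: (@smooth_function_diff (fun q => g c q i j)) (riem_smooth riem c i j).
Qed.

Lemma metric_sym c p i j : cdom c p -> g c p i j = g c p j i.
Proof. by move=> cp; rewrite -{1}(riem_sym riem cp) mxE. Qed.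

Lemma metric_unit c p : cdom c p -> g c p \in unitmx.
Proof.
move=> cp; rewrite unitmxE unitfE; apply/negP => /det0P[v v0 vg].
by have := riem_pos riem cp v0; rewrite /metric_at vg mul0mx mxE ltxx.
Qed.

(** Metric compatibility: the derivative of g(s', s') is twice g(acceleration, s').
    In coordinates the terms that are cubic in the velocity combine because all three
    contractions of the derivative of [g] with the velocity agree. *)
Lemma is_derive_sq_speed c t : J t -> cdom c (s t) ->
  is_derive t 1 (sq_speed g)
    (2 * \sum_m lowered_acc g c (s t) (velocity c s t) (acceleration c s t) m *
        velocity c s t 0 m).
Proof.
move=> Jt ct; have Jct : in_chart J s c t by [].
set v := velocity c s; set a := acceleration c s.
have dv i : is_derive t 1 (fun u => v u 0 i) (a t 0 i).
  have dv := derivable_velocity Jt ct.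
  apply: DeriveDef; first exact: (derivable_rVP _ _).1 dv i.
  by rewrite -derive1E -derive1_coord.
have dgij i j : is_derive t 1 (fun u => g c (s u) i j)
    (\sum_b dmetric g c (s t) b i j * v t 0 b).
  exact: (@is_derive_along (fun q => g c q i j)) (metric_diff _ _ ct).
pose F i j := (fun u => v u 0 i) * (fun u => g c (s u) i j) * (fun u => v u 0 j).
have dF : is_derive t 1 (\sum_i \sum_j F i j) _ :=
  is_derive_sum (fun i => is_derive_sum (fun j =>
    is_deriveM (is_deriveM (dv i) (dgij i j)) (dv j))).
apply: (@near_eq_is_derive _ _ _ (\sum_i \sum_j F i j)).
  apply: (open_near (@oJc c) Jct) => u [Ju cu].
  rewrite (sq_speedE Ju cu) metric_atE fct_sumE; apply: eq_bigr => i _.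
  by rewrite fct_sumE; apply: eq_bigr.
apply: is_derive_eq dF _.
pose D := dmetric g c (s t).
pose T := \sum_b \sum_i \sum_j D b i j * v t 0 b * v t 0 i * v t 0 j.
pose S := \sum_m (a t *m g c (s t)) 0 m * v t 0 m.
have S1 : \sum_i \sum_j v t 0 j * g c (s t) i j * a t 0 i = S.
  rewrite exchange_big; apply: eq_bigr => j _ /=; rewrite mxE mulr_suml.
  by apply: eq_bigr => i _; ring.
have S2 : \sum_i \sum_j v t 0 i * g c (s t) i j * a t 0 j = S.
  rewrite -S1 exchange_big; apply: eq_bigr => i _; apply: eq_bigr => j _ /=.
  by rewrite (metric_sym _ _ ct).
have T0 : \sum_i \sum_j \sum_b D b i j * v t 0 b * v t 0 i * v t 0 j = T.
  by rewrite /T [RHS]exchange_big; apply: eq_bigr => i _; rewrite exchange_big.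
have T1 : \sum_m (\sum_i \sum_j D i j m * v t 0 i * v t 0 j) * v t 0 m = T.
  under eq_bigr do rewrite mulr_suml.
  rewrite exchange_big; apply: eq_bigr => i _ /=; under eq_bigr do rewrite mulr_suml.
  by rewrite exchange_big.
have T2 : \sum_m (\sum_i \sum_j D m i j * v t 0 i * v t 0 j) * v t 0 m = T.
  apply: eq_bigr => m _; rewrite mulr_suml; apply: eq_bigr => i _.
  by rewrite mulr_suml; apply: eq_bigr => j _; ring.
transitivity (T + S + S).
  rewrite -T0 -{1}S1 -S2 -!big_split; apply: eq_bigr => i _ /=.
  rewrite -!big_split; apply: eq_bigr => j _ /=.
  rewrite /GRing.scale /= !fctE -!mulr_suml -/D -/v -/a.
  by ring.
transitivity (2 * (S + T - 2^-1 * T)); first by field.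
congr (2 * _); rewrite -{1}T1 -T2 /S mulr_sumr -sumrN -!big_split.
apply: eq_bigr => m _ /=; rewrite /lowered_acc -/D.
by ring.
Qed.

End OneCurve.
End Curves.

(** * Changes of parameter of the unit interval *)

Section UnitInterval.
Context {R : realType}.

Lemma unit_itvE (t : R) : unit_itv t <-> 0 <= t <= 1.
Proof. by rewrite /unit_itv /= in_itv. Qed.

Lemma Rintegral_unit_itv (f F : R -> R) :
  (forall t, unit_itv t -> is_derive t 1 F (f t)) ->
  (forall t, unit_itv t -> {for t, continuous f}) ->
  \int[lebesgue_measure]_(x in unit_itv) f x = F 1 - F 0.
Proof.
move=> dF cf.
have cF t : unit_itv t -> {for t, continuous F}.
  by move=> /dF[dFt _]; apply/differentiable_continuous/derivable1_diffP.
have u0 : @unit_itv R 0 by apply/unit_itvE; rewrite lexx ler01.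
have u1 : @unit_itv R 1 by apply/unit_itvE; rewrite lexx ler01.
rewrite /Rintegral (@continuous_FTC2 _ f F 0 1) //.
- by apply: continuous_in_subspaceT => x; rewrite inE => ux; exact: cf.
- split; first by move=> x /subset_itv_oo_cc ux; have [] := dF x ux.
  + by apply: cvg_at_right_filter; exact: cF.
  + by apply: cvg_at_left_filter; exact: cF.
- by move=> x /subset_itv_oo_cc ux; rewrite derive1E; have [_] := dF x ux.
Qed.

Lemma derive0_unit_itv (F : R -> R) :
  (forall t, unit_itv t -> is_derive t 1 F 0) ->
  forall t, unit_itv t -> F t = F 0.
Proof.
move=> dF t /unit_itvE /andP[t0 t1].
have I s : 0 <= s <= t -> unit_itv s.
  by move=> /andP[s0 st]; apply/unit_itvE; rewrite s0 (le_trans st).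
have cF : {within `[0, t], continuous F}.
  apply: derivable_within_continuous => s.
  by rewrite in_itv => /I/dF[].
have dF0 s : s \in `]0, t[ -> is_derive s 1 F 0.
  by rewrite in_itv => /andP[s0 st]; apply/dF/I; rewrite !ltW.
have [c _] := MVT_segment t0 dF0 cF.
by rewrite mul0r => /eqP; rewrite subr_eq0 => /eqP.
Qed.

Lemma is_derive_within (W : normedModType R) (J : set R) (f h : R -> W)
    (t : R) (l : W) :
  is_derive t 1 f l -> J t -> (forall s, J s -> h s = f s) ->
  derivative_within J h t l.
Proof.
move=> [df <-] Jt hf; rewrite /derivative_within.
have fl : s^-1 *: (f (t + s) - f t) @[s --> 0^'] --> 'D_1 f t.
  rewrite (_ : (fun s => _) =
    (fun s => s^-1 *: ((f \o shift t) (s *: (1 : R)) - f t))); first exact: df.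
  by apply/funext => s /=; rewrite (_ : s *: 1 = s) ?(addrC t) //; exact: mulr1.
apply: cvg_trans (@cvg_within_filter _ _ _ _ _ _ [set s | J (t + s)] fl).
apply: near_eq_cvg; apply: filterS (withinT _ _) => s /= Js.
by rewrite !hf.
Qed.

(** Close to 0, the points on its right belong to the unit interval; this reduces
    the uniqueness of derivatives within the interval to that of limits from the
    right. *)
Lemma at_right_unit_itv :
  (0 : R)^'+ --> within [set s : R | unit_itv (0 + s)] (0 : R)^'.
Proof.
move=> P nP; have n0 : nbhs (0 : R) (fun s => s != 0 -> unit_itv (0 + s) -> P s).
  exact: nP.
suff : nbhs (0 : R) (fun s => 0 < s -> P s) by [].
apply: filterS2 n0 (lt_nbhsl ltr01) => s Ps s1 s0.
apply: Ps; first by rewrite gt_eqF.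
by apply/unit_itvE; rewrite add0r !ltW.
Qed.

Lemma derivative_within_unique (W : normedModType R) (f h : R -> W) (l l' : W) :
  is_derive (0 : R) 1 f l -> (forall s, unit_itv s -> h s = f s) ->
  derivative_within unit_itv h 0 l' -> l = l'.
Proof.
move=> df hf hl'.
have u0 : @unit_itv R 0 by apply/unit_itvE; rewrite lexx ler01.
have hl := is_derive_within df u0 hf.
pose q s := s^-1 *: (h (0 + s) - h 0).
have ql : q s @[s --> (0 : R)^'+] --> l.
  exact: cvg_trans (cvg_app q at_right_unit_itv) hl.
have ql' : q s @[s --> (0 : R)^'+] --> l'.
  exact: cvg_trans (cvg_app q at_right_unit_itv) hl'.
exact: cvg_unique ql ql'.
Qed.

(** The change of parameter whose rate is proportional to a positive function [h],
    normalized so as to map the unit interval onto itself: [f] is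
    the primitive of [h / l] vanishing at 0, and [g] is its inverse. The integral of
    1 / h(g) is computed from g' = l / h(g), and the formula for g'' expresses that
    h(g) g' is constant. *)
Lemma normalized_primitive (J : set R) (a b : R) (h : R -> R) : open J ->
  `[a, b] `<=` J -> a < 0 -> 1 < b -> (forall m, mderivable m J h) ->
  (forall t, J t -> 0 < h t) ->
  exists (l : R) (f g : R -> R) (K : set R),
    [/\ 0 < l, \int[lebesgue_measure]_(t in unit_itv) h t = l,
        \int[lebesgue_measure]_(y in unit_itv) (h (g y))^-1 = l^-1,
        diffeomorphism unit_itv f & f 0 = 0 /\ f 1 = 1] /\
    [/\ forall t, unit_itv t -> is_derive t 1 f (h t / l),
        forall t, unit_itv t -> unit_itv (f t) /\ g (f t) = t &
        forall y, unit_itv y -> unit_itv (g y)] /\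
    [/\ open K, is_interval K, unit_itv `<=` K,
        forall y, K y -> J (g y) & forall m, mderivable m K g] /\
    (forall y, K y -> derive1 (derive1 g) y =
       - (derive1 h (g y) / h (g y)) * derive1 g y ^+ 2).
Proof.
move=> oJ abJ a0 b1 hS h0.
have dh t : J t -> derivable h t 1 by have [+ _] := hS 1%N; exact.
have ch t : J t -> {for t, continuous h}.
  by move=> Jt; apply/differentiable_continuous/derivable1_diffP/dh.
have [F dF] := @continuous_antiderivative _ h a b (fun t tab => ch t (abJ t tab)).
pose J0 : set R := `]a, b[%classic.
have oJ0 : open J0 by exact: interval_open.
have J0J t : J0 t -> J t by move=> /subset_itv_oo_cc/abJ.
have J0_01 : unit_itv `<=` J0.
  move=> t /unit_itvE /andP[t0 t1]; rewrite /J0 /= in_itv /=.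
  by rewrite (lt_le_trans a0) // (le_lt_trans t1).
have Fincr s t : J0 s -> J0 t -> s < t -> F s < F t.
  apply: (@gtr0_derive1_lt_oo _ F a b) => [x /dF[]//|x xab|x xab].
  - by rewrite derive1E; have [_ ->] := dF x xab; exact/h0/J0J.
  - have [dFx _] := dF x (set_mem xab).
    exact/differentiable_continuous/derivable1_diffP.
have u0 : @unit_itv R 0 by apply/unit_itvE; rewrite lexx ler01.
have u1 : @unit_itv R 1 by apply/unit_itvE; rewrite lexx ler01.
have F01 : F 0 < F 1 by apply: Fincr; [exact: J0_01|exact: J0_01|exact: ltr01].
pose l := F 1 - F 0; have l0 : 0 < l by rewrite subr_gt0.
pose f t := (F t - F 0) / l.
have df t : J0 t -> is_derive t 1 f (h t / l).
  move=> J0t; have dFt := dF t J0t.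
  rewrite (_ : f = l^-1 \*: (F - cst (F 0))).
    by apply: is_derive_eq; rewrite subr0 mulrC.
  by apply/funext => s; rewrite /f mulrC.
have f'E t : J0 t -> derive1 f t = h t / l.
  by move=> /df[_ <-]; rewrite derive1E.
have fS m : mderivable m J0 f.
  case: m => [//|m]; split=> [t /df[]//|].
  apply: (@eq_mderivable _ _ _ _ (fun t => h t * l^-1)) => // [t /f'E//|].
  by apply: mderivableM => //; [exact: sub_mderivable (hS m)|exact: mderivable_cst].
have f'0 t : J0 t -> 0 < derive1 f t.
  by move=> J0t; rewrite f'E // divr_gt0 // h0 //; exact: J0J.
have f0 : f 0 = 0 by rewrite /f subrr mul0r.
have f1 : f 1 = 1 by rewrite /f divff // gt_eqF.
have a'b' : a / 2 < (b + 1) / 2 by lra.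
have abJ0 : `[a / 2, (b + 1) / 2] `<=` J0.
  move=> t; rewrite /J0 /= !in_itv /= => /andP[at_ tb].
  by apply/andP; split; lra.
(* The inverse lives on the image of ]a / 2, (b + 1) / 2[, an interval that
   contains the unit interval and whose closure is contained in ]a, b[. *)
have [g [gK Kf dg gS]] := smooth_inverse oJ0 abJ0 fS f'0 a'b'.
set K : set R := `]f (a / 2), f ((b + 1) / 2)[%classic in gK Kf dg gS.
have I_ab t : unit_itv t -> t \in `]a / 2, (b + 1) / 2[.
  by move=> /unit_itvE /andP[t0 t1]; rewrite in_itv /=; apply/andP; split; lra.
have flt s t : J0 s -> J0 t -> s < t -> f s < f t.
  by move=> ? ? ?; rewrite ltr_pM2r ?invr_gt0 // ltrD2r Fincr.
have Ja : J0 (a / 2) by rewrite /J0 /= in_itv /=; apply/andP; split; lra.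
have Jb : J0 ((b + 1) / 2) by rewrite /J0 /= in_itv /=; apply/andP; split; lra.
have fa0 : f (a / 2) < 0 by rewrite -f0 flt //; [exact: J0_01|lra].
have fb1 : 1 < f ((b + 1) / 2).
  by have := flt _ _ (J0_01 1 u1) Jb; rewrite f1; apply; lra.
have IK : unit_itv `<=` K.
  move=> y /unit_itvE /andP[y0 y1]; rewrite /K /= in_itv /=.
  by rewrite (lt_le_trans fa0 y0) (le_lt_trans y1 fb1).
have gJ0 y : K y -> J0 (g y) by move=> /gK[/subset_itv_oo_cc/abJ0].
have gJ y : K y -> J (g y) by move=> /gJ0/J0J.
have fI t : unit_itv t -> unit_itv (f t).
  move=> It; have /andP[t0 t1] := (unit_itvE t).1 It; have J0t := J0_01 t It.
  apply/unit_itvE; apply/andP; split.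
    move: t0; rewrite le_eqVlt => /predU1P[<-|]; first by rewrite f0.
    by move=> /(flt _ _ (J0_01 0 u0) J0t); rewrite f0 => /ltW.
  move: t1; rewrite le_eqVlt => /predU1P[->|]; first by rewrite f1.
  by move=> /(flt _ _ J0t (J0_01 1 u1)); rewrite f1 => /ltW.
have gI y : unit_itv y -> unit_itv (g y).
  move=> Iy; have /andP[y0 y1] := (unit_itvE y).1 Iy; have [_ fg] := gK y (IK y Iy).
  have J0g := gJ0 y (IK y Iy); apply/unit_itvE; apply/andP; split.
    rewrite leNgt; apply/negP => /(flt _ _ J0g (J0_01 0 u0)).
    by rewrite fg f0 ltNge y0.
  rewrite leNgt; apply/negP => /(flt _ _ (J0_01 1 u1) J0g).
  by rewrite fg f1 ltNge y1.
have gf t : unit_itv t -> g (f t) = t by move=> /I_ab/Kf[].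
have oK : open K by exact: interval_open.
have g'E y : K y -> derive1 g y = l / h (g y).
  move=> Ky; rewrite derive1E; have [_ ->] := dg y Ky.
  by rewrite f'E ?invf_div //; exact: gJ0.
have g''E y : K y ->
    derive1 (derive1 g) y = - (derive1 h (g y) / h (g y)) * derive1 g y ^+ 2.
  move=> Ky; have hgy : h (g y) != 0 by rewrite gt_eqF // h0 //; exact: gJ.
  rewrite (eq_derive1_on oK Ky g'E) derive1E.
  have [dgy dgyE] := dg y Ky; rewrite -derive1E in dgyE.
  have dhg : is_derive y 1 (h \o g) (derive1 h (g y) * derive1 g y).
    have dhg : is_derive (g y) 1 h (derive1 h (g y)).
      by rewrite derive1E; apply: derivableP; exact/dh/gJ.
    have dg' : is_derive y 1 g (derive1 g y).
      by rewrite derive1E; exact: derivableP.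
    exact: (@is_derive1_comp _ h g y _ _ dhg dg').
  have dl : is_derive y 1 (fun y => l / h (g y))
      (l *: (- (h (g y)) ^- 2 *: (derive1 h (g y) * derive1 g y))).
    exact: (is_deriveZ _ (@is_deriveV _ (h \o g) _ _ _ hgy dhg)).
  have [_ ->] := dl; rewrite g'E // /GRing.scale /=; field.
  by rewrite hgy.
have intl : \int[lebesgue_measure]_(t in unit_itv) h t = l.
  have dFI t : unit_itv t -> is_derive t 1 F (h t) by move=> /J0_01; exact: dF.
  have chI t : unit_itv t -> {for t, continuous h} by move=> /J0_01/J0J; exact: ch.
  exact: Rintegral_unit_itv dFI chI.
have intV : \int[lebesgue_measure]_(y in unit_itv) (h (g y))^-1 = l^-1.
  have dG y : unit_itv y -> is_derive y 1 (l^-1 \*: g) (h (g y))^-1.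
    move=> /IK Ky; have [dgy _] := dg y Ky.
    have d1 : is_derive y 1 g (derive1 g y) by rewrite derive1E; exact: derivableP.
    apply: is_derive_eq (is_deriveZ l^-1 d1) _.
    by rewrite g'E // /GRing.scale /= mulKf // gt_eqF.
  have cI y : unit_itv y -> {for y, continuous (fun y => (h (g y))^-1)}.
    move=> /IK Ky; have [dgy _] := dg y Ky.
    have hg0 : h (g y) != 0 by rewrite gt_eqF // h0 //; exact: gJ.
    have cg : {for y, continuous g}.
      exact/differentiable_continuous/derivable1_diffP.
    have chg : {for y, continuous (h \o g)}.
      by apply: continuous_comp => //; exact/ch/gJ.
    exact: (@continuousV _ _ (h \o g)).
  have g0 : g 0 = 0 by rewrite -{1}f0 gf.
  have g1 : g 1 = 1 by rewrite -{1}f1 gf.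
  by rewrite (Rintegral_unit_itv dG cI) /= g0 g1 scaler0 subr0; exact: mulr1.
exists l, f, g, K; split; [split=> //|split; [split=> //|split; [split=> //|]]].
- split.
    exists J0, f; split=> //; first exact: interval_is_interval.
    exact: (mderivableP _ _).1 fS.
  exists g; split=> //; last by move=> t /IK/gK[].
  exists K, g; split=> //; first exact: interval_is_interval.
  exact: (mderivableP _ _).1 gS.
- by move=> t /J0_01; exact: df.
- by move=> t It; split; [exact: fI|exact: gf].
- exact: interval_is_interval.
- exact: g''E.
Qed.

End UnitInterval.

(** * Reparametrized curves and curves in a product *)

Section VectorDerivatives.
Context {R : realType}.

Lemma derive1_comp_rV n (x : R -> 'rV[R]_n) (th : R -> R) t :
  derivable th t 1 -> derivable x (th t) 1 ->
  derivable (x \o th) t 1 /\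
  derive1 (x \o th) t = derive1 th t *: derive1 x (th t).
Proof.
move=> dth dx.
have dxt : derivable (x \o th) t 1.
  apply/derivable1_diffP/differentiable_comp; exact/derivable1_diffP.
split=> //; apply/rowP => i; rewrite derive1_coord // mxE derive1_coord //.
have dxi := (derivable_rVP _ _).1 dx i.
by apply: etrans (@derive1_comp _ th (fun s => x s 0 i) t dth dxi) _; rewrite mulrC.
Qed.

Lemma derive1_scale_rV n (x : R -> 'rV[R]_n) (a : R -> R) t :
  derivable a t 1 -> derivable x t 1 ->
  derive1 (fun s => a s *: x s) t = derive1 a t *: x t + a t *: derive1 x t.
Proof.
move=> da dx.
have dxi i := (derivable_rVP _ _).1 dx i.
have E i : (fun s => (a s *: x s) 0 i) = a * (fun s => x s 0 i).
  by apply/funext => s; rewrite mxE.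
have dax : derivable (fun s => a s *: x s) t 1.
  by apply/derivable_rVP => i; rewrite E; exact: (derivableM da (dxi i)).
apply/rowP => i; rewrite (derive1_coord i dax) E derive1E (deriveM da (dxi i)).
rewrite [RHS]mxE [in RHS]mxE [X in _ = _ + X]mxE (derive1_coord i dx).
by rewrite -!derive1E [LHS]addrC; congr (_ + _); exact: mulrC.
Qed.

Lemma derive1_row_mx n1 n2 (x : R -> 'rV[R]_n1) (y : R -> 'rV[R]_n2) t :
  derivable x t 1 -> derivable y t 1 ->
  derive1 (fun s => row_mx (x s) (y s)) t = row_mx (derive1 x t) (derive1 y t).
Proof.
move=> dx dy.
have El i : (fun s => row_mx (x s) (y s) 0 (lshift n2 i)) = (fun s => x s 0 i).
  by apply/funext => s; rewrite row_mxEl.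
have Er i : (fun s => row_mx (x s) (y s) 0 (rshift n1 i)) = (fun s => y s 0 i).
  by apply/funext => s; rewrite row_mxEr.
have d : derivable (fun s => row_mx (x s) (y s)) t 1.
  apply/derivable_rVP => i; case: (split_ordP i) => j ->.
    by rewrite El; exact: (derivable_rVP _ _).1 dx j.
  by rewrite Er; exact: (derivable_rVP _ _).1 dy j.
apply/rowP => i; rewrite derive1_coord //.
case: (split_ordP i) => j ->.
  by rewrite El row_mxEl derive1_coord.
by rewrite Er row_mxEr derive1_coord.
Qed.

End VectorDerivatives.

Section CurveReparametrization.
Context {R : realType} {n : nat} {M : topologicalType} {A : atlas R n M}.
Hypothesis mfd : smooth_manifold A.
Variables (J K : set R) (s : R -> M) (th : R -> R).
Hypotheses (oJ : open J) (sS : smooth_curve A J s).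
Hypotheses (oK : open K) (KJ : forall y, K y -> J (th y)).
Hypothesis thS : forall m, mderivable m K th.

Let dth y : K y -> derivable th y 1.
Proof. by have [+ _] := thS 1%N; apply. Qed.

Let cth y : K y -> {for y, continuous th}.
Proof. by move=> Ky; apply/differentiable_continuous/derivable1_diffP/dth. Qed.

Let cs t : J t -> {for t, continuous s}.
Proof. by move=> /sS[]. Qed.

Lemma continuous_reparam y : K y -> {for y, continuous (s \o th)}.
Proof. by move=> Ky; apply: continuous_comp; [exact: cth|exact/cs/KJ]. Qed.

Lemma smooth_curve_reparam : smooth_curve A K (s \o th).
Proof.
apply: mderivable_smooth_curve; first exact: continuous_reparam.
move=> c m; have oKc := open_in_chart mfd (c := c) oK continuous_reparam.
have oJc := open_in_chart mfd (c := c) oJ cs.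
apply/(mderivable_rVP m _ oKc) => i.
have xi := (mderivable_rVP m _ oJc).1 (smooth_curve_mderivable sS c m) i.
apply: (mderivable_comp oKc _ xi); last by apply: sub_mderivable (thS m) => y [].
by move=> y [Ky cy]; split=> //; exact: KJ.
Qed.

Lemma velocity_reparam (c : chart A) y : K y -> cdom c (s (th y)) ->
  velocity c (s \o th) y = derive1 th y *: velocity c s (th y).
Proof.
move=> Ky cy.
exact: (derive1_comp_rV (dth Ky) (derivable_chart sS (KJ Ky) cy)).2.
Qed.

Lemma acceleration_reparam (c : chart A) y : K y -> cdom c (s (th y)) ->
  acceleration c (s \o th) y = derive1 (derive1 th) y *: velocity c s (th y)
    + derive1 th y ^+ 2 *: acceleration c s (th y).
Proof.
move=> Ky cy; have Kcy : in_chart K (s \o th) c y by [].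
have oKc := open_in_chart mfd (c := c) oK continuous_reparam.
have [dv vE] := derive1_comp_rV (dth Ky) (derivable_velocity sS (KJ Ky) cy).
have dth' : derivable (derive1 th) y 1 by have [_ [+ _]] := thS 2; apply.
have := derive1_scale_rV dth' dv; rewrite vE scalerA -expr2 => <-.
apply: (eq_derive1_on oKc Kcy) => u [Ku cu]; exact: velocity_reparam.
Qed.

End CurveReparametrization.

Section ProductCurves.
Context {R : realType} {n1 n2 : nat} {M1 M2 : topologicalType}.
Context {A1 : atlas R n1 M1} {A2 : atlas R n2 M2}.
Hypotheses (mfd1 : smooth_manifold A1) (mfd2 : smooth_manifold A2).

Section Factors.
Variables (J : set R) (s : R -> M1 * M2).
Hypotheses (oJ : open J) (sS : smooth_curve (prod_atlas A1 A2) J s).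

Let c1S t : J t -> {for t, continuous (fst \o s)}.
Proof.
by move=> /sS[cs _]; apply: continuous_comp => //; exact: cvg_fst.
Qed.

Let c2S t : J t -> {for t, continuous (snd \o s)}.
Proof.
by move=> /sS[cs _]; apply: continuous_comp => //; exact: cvg_snd.
Qed.

Let coordS (c1 : chart A1) (c2 : chart A2) m :
  mderivable m (in_chart J (fst \o s) c1 `&` in_chart J (snd \o s) c2)
  (fun t => row_mx (coord c1 (s t).1) (coord c2 (s t).2)).
Proof.
apply: sub_mderivable
  (smooth_curve_mderivable sS ((c1, c2) : chart (prod_atlas A1 A2)) m).
by move=> t [[Jt ct1] [_ ct2]]; split.
Qed.

Lemma smooth_curve_fst : smooth_curve A1 J (fst \o s).
Proof.
apply: mderivable_smooth_curve => // c1 m; apply: mderivable_local => t [Jt ct1].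
have [c2 ct2] := mfd_cover mfd2 (s t).2.
exists (in_chart J (fst \o s) c1 `&` in_chart J (snd \o s) c2); split=> //.
have oD : open (in_chart J (fst \o s) c1 `&` in_chart J (snd \o s) c2).
  by apply: openI; [exact: (open_in_chart mfd1)|exact: (open_in_chart mfd2)].
apply/(mderivable_rVP m _ oD) => i.
apply: eq_mderivable
  ((mderivable_rVP m _ oD).1 (coordS c1 c2 m) (lshift n2 i)) => // u _.
by rewrite row_mxEl.
Qed.

Lemma smooth_curve_snd : smooth_curve A2 J (snd \o s).
Proof.
apply: mderivable_smooth_curve => // c2 m; apply: mderivable_local => t [Jt ct2].
have [c1 ct1] := mfd_cover mfd1 (s t).1.
exists (in_chart J (fst \o s) c1 `&` in_chart J (snd \o s) c2); split=> //.
have oD : open (in_chart J (fst \o s) c1 `&` in_chart J (snd \o s) c2).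
  by apply: openI; [exact: (open_in_chart mfd1)|exact: (open_in_chart mfd2)].
apply/(mderivable_rVP m _ oD) => i.
apply: eq_mderivable
  ((mderivable_rVP m _ oD).1 (coordS c1 c2 m) (rshift n1 i)) => // u _.
by rewrite row_mxEr.
Qed.

End Factors.

Section Pair.
Variables (J : set R) (s1 : R -> M1) (s2 : R -> M2).
Hypotheses (oJ : open J) (s1S : smooth_curve A1 J s1) (s2S : smooth_curve A2 J s2).

Let cs1 t : J t -> {for t, continuous s1}.
Proof. by move=> /s1S[]. Qed.

Let cs2 t : J t -> {for t, continuous s2}.
Proof. by move=> /s2S[]. Qed.

Let s t := (s1 t, s2 t).

Let in_chartE (c : chart (prod_atlas A1 A2)) : in_chart J s c =
  in_chart J s1 c.1 `&` in_chart J s2 c.2.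
Proof. by apply/seteqP; split=> t [] => [Jt []|[Jt ?] []]. Qed.

Let oD (c1 : chart A1) (c2 : chart A2) : open (in_chart J s1 c1 `&` in_chart J s2 c2).
Proof.
by apply: openI; [exact: (open_in_chart mfd1)|exact: (open_in_chart mfd2)].
Qed.

Lemma smooth_curve_pair : smooth_curve (prod_atlas A1 A2) J s.
Proof.
apply: mderivable_smooth_curve => [t Jt|c m].
  by apply: cvg_pair; [exact: cs1|exact: cs2].
rewrite in_chartE; apply/(mderivable_rVP m _ (@oD _ _)) => i.
case: (split_ordP i) => j ->.
  have x1 := (mderivable_rVP m _ (@oD _ _)).1
    (sub_mderivable (@subIsetl _ _ (in_chart J s2 c.2))
      (smooth_curve_mderivable s1S c.1 m)) j.
  by apply: eq_mderivable x1 => //= t _; rewrite row_mxEl.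
have x2 := (mderivable_rVP m _ (@oD _ _)).1
  (sub_mderivable (@subIsetr _ (in_chart J s1 c.1) _)
    (smooth_curve_mderivable s2S c.2 m)) j.
by apply: eq_mderivable x2 => //= t _; rewrite row_mxEr.
Qed.

Lemma velocity_pair (c : chart (prod_atlas A1 A2)) t : in_chart J s c t ->
  velocity c s t = row_mx (velocity c.1 s1 t) (velocity c.2 s2 t).
Proof.
rewrite in_chartE => -[[Jt ct1] [_ ct2]]; apply: derive1_row_mx.
  exact: (derivable_chart s1S Jt ct1).
exact: (derivable_chart s2S Jt ct2).
Qed.

Lemma acceleration_pair (c : chart (prod_atlas A1 A2)) t : in_chart J s c t ->
  acceleration c s t = row_mx (acceleration c.1 s1 t) (acceleration c.2 s2 t).
Proof.
move=> sct; have := sct; rewrite in_chartE => -[[Jt ct1] [_ ct2]].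
have oc : open (in_chart J s (c : chart (prod_atlas A1 A2))).
  by rewrite in_chartE; exact: oD.
rewrite {1}/acceleration (eq_derive1_on oc sct (@velocity_pair c)).
apply: derive1_row_mx.
  exact: (derivable_velocity s1S Jt ct1).
exact: (derivable_velocity s2S Jt ct2).
Qed.

End Pair.
End ProductCurves.

(** * Geodesics of warped products *)

Section GeodesicEquations.
Context {R : realType}.

Definition nondegenerate (n : nat) (M : topologicalType) (A : atlas R n M)
    (g : metric A) : Prop :=
  forall c p, cdom c p -> (g c p)^T = g c p /\ g c p \in unitmx.

Lemma riemannian_nondegenerate (n : nat) (M : topologicalType) (A : atlas R n M)
  (g : metric A) : riemannian g -> nondegenerate g.
Proof.
by move=> riem c p cp; split; [exact: (riem_sym riem)|exact: metric_unit].
Qed.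

Lemma geodesic_eqP (n : nat) (M : topologicalType) (A : atlas R n M)
    (g : metric A) s t : nondegenerate g ->
  geodesic_eq g s t <-> forall c, cdom c (s t) -> forall m,
    lowered_acc g c (s t) (velocity c s t) (acceleration c s t) m = 0.
Proof.
by move=> ng; split=> H c ct; have [gT gU] := ng c _ ct;
  have [? ?] := lowered_acc_eq0 (velocity c s t) (acceleration c s t) gT gU;
  move: (H c ct).
Qed.

Context {n1 n2 : nat} {M1 M2 : topologicalType}.
Context {A1 : atlas R n1 M1} {A2 : atlas R n2 M2}.

Lemma warped_nondegenerate (g1 : metric A1) (g2 : metric A2) (k : M1 -> R) :
  nondegenerate g1 -> nondegenerate g2 -> (forall p, k p != 0) ->
  nondegenerate (warped_metric g1 k g2).
Proof.
move=> ng1 ng2 k0 c p [/ng1[g1T g1U] /ng2[g2T g2U]]; split.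
  by rewrite /warped_metric tr_block_mx !trmx0 g1T linearZ /= g2T.
move: g1U g2U; rewrite !unitmxE !unitfE /warped_metric det_ublock detZ => d1 d2.
by rewrite mulf_neq0 // mulf_neq0 // expf_neq0 // oppr_eq0.
Qed.

Hypotheses (mfd1 : smooth_manifold A1) (mfd2 : smooth_manifold A2).

(** The geodesic equations of a warped product, separated into the two factors. The
    constant function -1 is allowed for [k], which covers Riemannian products. *)
Lemma geodesic_eq_warped (g1 : metric A1) (g2 : metric A2) (k : M1 -> R)
    (J : set R) (s1 : R -> M1) (s2 : R -> M2) t :
  nondegenerate g1 -> riemannian g2 -> (forall p, k p != 0) ->
  (forall (c : chart A1) p, cdom c p -> differentiable (k \o param c) (coord c p)) ->
  open J -> smooth_curve A1 J s1 -> smooth_curve A2 J s2 -> J t ->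
  geodesic_eq (warped_metric g1 k g2) (fun t => (s1 t, s2 t)) t <->
  forall (c1 : chart A1) (c2 : chart A2), cdom c1 (s1 t) -> cdom c2 (s2 t) ->
    (forall m, lowered_acc g1 c1 (s1 t) (velocity c1 s1 t) (acceleration c1 s1 t) m
       + 2^-1 * partial k c1 (s1 t) m *
         metric_at g2 c2 (s2 t) (velocity c2 s2 t) (velocity c2 s2 t) = 0) /\
    (forall m, k (s1 t) *
         lowered_acc g2 c2 (s2 t) (velocity c2 s2 t) (acceleration c2 s2 t) m
       + (\sum_a partial k c1 (s1 t) a * velocity c1 s1 t 0 a) *
         (velocity c2 s2 t *m g2 c2 (s2 t)) 0 m = 0).
Proof.
move=> ng1 riem2 k0 dk oJ s1S s2S Jt.
have ng2 := riemannian_nondegenerate riem2.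
have ng := warped_nondegenerate ng1 ng2 k0.
have acc c1 c2 (ct1 : cdom c1 (s1 t)) (ct2 : cdom c2 (s2 t)) :
    let c := (c1, c2) : chart (prod_atlas A1 A2) in
    let s u := (s1 u, s2 u) in
    let a := lowered_acc (warped_metric g1 k g2) c (s t)
      (velocity c s t) (acceleration c s t) in
    (forall m, a (lshift n2 m) =
       lowered_acc g1 c1 (s1 t) (velocity c1 s1 t) (acceleration c1 s1 t) m
       + 2^-1 * partial k c1 (s1 t) m *
         metric_at g2 c2 (s2 t) (velocity c2 s2 t) (velocity c2 s2 t)) /\
    (forall m, a (rshift n1 m) = - (k (s1 t) *
         lowered_acc g2 c2 (s2 t) (velocity c2 s2 t) (acceleration c2 s2 t) m
       + (\sum_a partial k c1 (s1 t) a * velocity c1 s1 t 0 a) *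
         (velocity c2 s2 t *m g2 c2 (s2 t)) 0 m)).
  move=> c s a.
  have cst : in_chart J s c t by split.
  have dk' i : derivable (k \o param c1) (coord c1 (s1 t)) (delta_mx 0 i).
    exact/diff_derivable/dk.
  have dg2 i j b : derivable (fun u => g2 c2 (param c2 u) i j)
      (coord c2 (s2 t)) (delta_mx 0 b).
    exact/diff_derivable/metric_diff.
  have pK1 := mfd_coordK mfd1 ct1; have pK2 := mfd_coordK mfd2 ct2.
  rewrite /a (velocity_pair s1S s2S cst).
  rewrite (acceleration_pair mfd1 mfd2 oJ s1S s2S cst) /=.
  split=> m; first exact: lowered_acc_warpedl.
  by rewrite lowered_acc_warpedr // opprD.
split.
  move/(geodesic_eqP _ _ ng) => geo c1 c2 ct1 ct2.
  have [al ar] := acc c1 c2 ct1 ct2.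
  have geo' := geo ((c1, c2) : chart (prod_atlas A1 A2)) (conj ct1 ct2).
  split=> m; first by rewrite -al; exact: geo'.
  by apply/eqP; rewrite -oppr_eq0 -ar; apply/eqP; exact: geo'.
move=> H; apply/(geodesic_eqP _ _ ng) => -[c1 c2] [/= ct1 ct2] m.
have [al ar] := acc c1 c2 ct1 ct2; have [Hl Hr] := H c1 c2 ct1 ct2.
case: (split_ordP m) => j ->; first by rewrite al Hl.
by rewrite ar Hr oppr0.
Qed.

End GeodesicEquations.

(** * First integrals and Maupertuis' principle *)

Section Maupertuis.
Context {R : realType} {n1 n2 : nat} {M1 M2 : topologicalType}.
Context {A1 : atlas R n1 M1} {A2 : atlas R n2 M2}.
Hypotheses (mfd1 : smooth_manifold A1) (mfd2 : smooth_manifold A2).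
Variables (g1 : metric A1) (g2 : metric A2) (k : M1 -> R).
Hypotheses (riem1 : riemannian g1) (riem2 : riemannian g2).
Hypotheses (k_smooth : smooth_function A1 k) (k_gt0 : forall p, 0 < k p).

Variables (J : set R) (s1 : R -> M1) (s2 : R -> M2).
Hypotheses (oJ : open J) (s1S : smooth_curve A1 J s1) (s2S : smooth_curve A2 J s2).

Local Notation e1 := (sq_speed mfd1 s1 g1).
Local Notation e2 := (sq_speed mfd2 s2 g2).

Let k_neq0 p : k p != 0. Proof. by rewrite gt_eqF. Qed.

Let dk (c : chart A1) p : cdom c p -> differentiable (k \o param c) (coord c p).
Proof. exact: smooth_function_diff. Qed.

Definition dk_along (c : chart A1) t : R :=
  \sum_a partial k c (s1 t) a * velocity c s1 t 0 a.

Lemma is_derive_k c t : J t -> cdom c (s1 t) ->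
  is_derive t 1 (k \o s1) (dk_along c t).
Proof. by move=> Jt ct; apply: (is_derive_along mfd1 oJ s1S) => //; exact: dk. Qed.

Section AtTime.
Variable t : R.
Hypothesis Jt : J t.
Hypothesis geo : geodesic_eq (warped_metric g1 k g2) (fun t => (s1 t, s2 t)) t.

Lemma warped_accelerations (c1 : chart A1) (c2 : chart A2) :
  cdom c1 (s1 t) -> cdom c2 (s2 t) ->
  (forall m, lowered_acc g1 c1 (s1 t) (velocity c1 s1 t) (acceleration c1 s1 t) m
     = - (2^-1 * partial k c1 (s1 t) m * e2 t)) /\
  (forall m,
    lowered_acc g2 c2 (s2 t) (velocity c2 s2 t) (acceleration c2 s2 t) m
     = - (dk_along c1 t / k (s1 t) * (velocity c2 s2 t *m g2 c2 (s2 t)) 0 m)).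
Proof.
move=> ct1 ct2.
have [H1 H2] := (geodesic_eq_warped mfd1 mfd2 (riemannian_nondegenerate riem1)
  riem2 k_neq0 dk oJ s1S s2S Jt).1 geo c1 c2 ct1 ct2.
rewrite (sq_speedE mfd2 oJ s2S riem2 Jt ct2).
split=> m; first by apply/eqP; rewrite -addr_eq0 H1.
have /eqP := H2 m; rewrite addr_eq0 => /eqP E.
apply: (mulfI (k_neq0 (s1 t))); rewrite E /dk_along; field.
exact: k_neq0.
Qed.

Lemma is_derive_e2 c1 : cdom c1 (s1 t) ->
  is_derive t 1 e2 (- (2 * (dk_along c1 t / k (s1 t)) * e2 t)).
Proof.
move=> ct1; have [c2 ct2] := mfd_cover mfd2 (s2 t).
apply: is_derive_eq (is_derive_sq_speed mfd2 oJ s2S riem2 Jt ct2) _.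
have [_ H2] := warped_accelerations ct1 ct2.
rewrite (sq_speedE mfd2 oJ s2S riem2 Jt ct2) metric_at_sum !mulr_sumr -sumrN.
by apply: eq_bigr => m _; rewrite H2; ring.
Qed.

Lemma is_derive_e1 c1 : cdom c1 (s1 t) ->
  is_derive t 1 e1 (- (dk_along c1 t * e2 t)).
Proof.
move=> ct1; have [c2 ct2] := mfd_cover mfd2 (s2 t).
apply: is_derive_eq (is_derive_sq_speed mfd1 oJ s1S riem1 Jt ct1) _.
have [H1 _] := warped_accelerations ct1 ct2.
rewrite /dk_along mulr_sumr mulr_suml -sumrN; apply: eq_bigr => m _.
by rewrite H1; field.
Qed.

(** Conservation of the squared momentum of the fibre: the friction along the
    fibre is exactly compensated by the variation of [k]. *)
Lemma is_derive_momentum : is_derive t 1 (fun t => k (s1 t) ^+ 2 * e2 t) 0.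
Proof.
have [c1 ct1] := mfd_cover mfd1 (s1 t).
have dkt := is_derive_k Jt ct1; have de2 := is_derive_e2 ct1.
apply: is_derive_eq (is_deriveM (is_deriveM dkt dkt) de2) _.
rewrite /GRing.scale /= !fctE; field.
exact: k_neq0.
Qed.

(** The work of the force on the base is - e2 dk(s1'), and k e2 varies by the same
    amount because k^2 e2 is constant. *)
Lemma is_derive_energy : is_derive t 1 (fun t => e1 t - k (s1 t) * e2 t) 0.
Proof.
have [c1 ct1] := mfd_cover mfd1 (s1 t).
have dkt := is_derive_k Jt ct1; have de2 := is_derive_e2 ct1.
have de1 := is_derive_e1 ct1.
apply: is_derive_eq (is_deriveB de1 (is_deriveM dkt de2)) _.
rewrite /GRing.scale /= ?fctE; field.
exact: k_neq0.
Qed.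

End AtTime.

Variables (r C : R).
Hypothesis f_gt0 : forall p, 0 < (k p)^-1 + r.

Let f p := (k p)^-1 + r.

Let f_neq0 p : f p != 0. Proof. by rewrite gt_eqF // f_gt0. Qed.

Let df (c : chart A1) p : cdom c p -> differentiable (f \o param c) (coord c p).
Proof.
move=> cp; apply: differentiableD; last exact: differentiable_cst.
apply: (@differentiableV _ _ (k \o param c)); first exact: dk.
exact: k_neq0.
Qed.

Lemma partial_inv (c : chart A1) p a : cdom c p ->
  partial f c p a = - (partial k c p a / k p ^+ 2).
Proof.
move=> cp; rewrite /partial.
have dka : derivable (k \o param c) (coord c p) (delta_mx 0 a).
  exact/diff_derivable/dk.
have pK := mfd_coordK mfd1 cp.
have kn0 : (k \o param c) (coord c p) != 0 by exact: k_neq0.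
rewrite (_ : f \o param c = (fun u => ((k \o param c) u)^-1) + cst r) //.
rewrite deriveD; last exact: derivable_cst; last exact: derivableV.
rewrite derive_cst addr0 deriveV // scaleNr /= pK.
by congr (- _); rewrite mulrC.
Qed.

Lemma conformal_nondegenerate : nondegenerate (conformal_metric g1 k r).
Proof.
move=> c p cp; have [gT gU] := riemannian_nondegenerate riem1 cp; split.
  by rewrite /conformal_metric linearZ /= gT.
move: gU; rewrite !unitmxE !unitfE detZ => gU.
by rewrite mulf_neq0 // expf_neq0 // f_neq0.
Qed.

Lemma prod_metricE (G1 : metric A1) :
  prod_metric G1 g2 = warped_metric G1 (fun=> -1) g2.
Proof.
by apply/funext => c; apply/funext => p; rewrite /warped_metric opprK scale1r.
Qed.

Variables (K : set R) (th1 th2 : R -> R).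
Hypotheses (oK : open K) (KJ1 : forall y, K y -> J (th1 y))
  (KJ2 : forall y, K y -> J (th2 y)).
Hypotheses (th1S : forall m, mderivable m K th1) (th2S : forall m, mderivable m K th2).
Let h1 t := (k (s1 t))^-1 + r.
Let h2 t := (k (s1 t))^-1.
Hypothesis th1'' : forall y, K y -> derive1 (derive1 th1) y =
  - (derive1 h1 (th1 y) / h1 (th1 y)) * derive1 th1 y ^+ 2.
Hypothesis th2'' : forall y, K y -> derive1 (derive1 th2) y =
  - (derive1 h2 (th2 y) / h2 (th2 y)) * derive1 th2 y ^+ 2.

(** Maupertuis' principle. Along the base, the choice of the parameter cancels the
    tangential terms that come from the reparametrization and from the conformal
    factor f = 1/k + r; what remains is f times the force - e2 dk / 2 of the warped
    product and the gradient term - e1 df / 2 of the conformal change. Since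
    df = - dk / k^2 and e1 = C f with C = k^2 e2, these cancel too. Along the
    fibre, the acceleration is tangential and the parameter is the one that
    removes it. *)
Lemma geodesic_eq_jacobi y : K y ->
  (forall t, t = th1 y \/ t = th2 y ->
    [/\ geodesic_eq (warped_metric g1 k g2) (fun t => (s1 t, s2 t)) t,
        k (s1 t) ^+ 2 * e2 t = C & e1 t = C * ((k (s1 t))^-1 + r)]) ->
  geodesic_eq (prod_metric (conformal_metric g1 k r) g2)
    (fun y => (s1 (th1 y), s2 (th2 y))) y.
Proof.
move=> Ky H.
have [geo1 C1 E1] := H _ (or_introl erefl).
have [geo2 C2 _] := H _ (or_intror erefl).
have [J1 J2] := (KJ1 Ky, KJ2 Ky).
rewrite prod_metricE.
have m0 (p : M1) : (-1 : R) != 0 by rewrite oppr_eq0 oner_eq0.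
have dm1 (c : chart A1) p : cdom c p ->
  differentiable ((fun=> -1 : R) \o param c) (coord c p).
  by move=> _; exact: differentiable_cst.
apply/(geodesic_eq_warped mfd1 mfd2 conformal_nondegenerate riem2 m0 dm1 oK
  (smooth_curve_reparam mfd1 oJ s1S oK KJ1 th1S)
  (smooth_curve_reparam mfd2 oJ s2S oK KJ2 th2S) Ky) => c1 c2 ct1 ct2.
have partial0 a : partial (fun=> -1 : R) c1 (s1 (th1 y)) a = 0.
  exact: derive_cst.
split=> m.
  rewrite /= partial0 mulr0 mul0r addr0.
  rewrite (velocity_reparam s1S KJ1 th1S Ky ct1).
  rewrite (acceleration_reparam mfd1 s1S oK KJ1 th1S Ky ct1).
  rewrite lowered_acc_reparam.
  have [c2' ct2'] := mfd_cover mfd2 (s2 (th1 y)).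
  have [acc1 _] := warped_accelerations J1 geo1 ct1 ct2'.
  rewrite (_ : lowered_acc _ _ _ _ _ m =
    lowered_acc (fun c p => f p *: g1 c p) c1 (s1 (th1 y))
      (velocity c1 s1 (th1 y)) (acceleration c1 s1 (th1 y)) m) //.
  rewrite lowered_acc_scale //; last 3 first.
  - exact: mfd_coordK.
  - by move=> a; exact/diff_derivable/df.
  - by move=> i j a; exact/diff_derivable/metric_diff.
  rewrite -(sq_speedE mfd1 oJ s1S riem1 J1 ct1) acc1 E1 -C1.
  have -> : (velocity c1 s1 (th1 y) *m conformal_metric g1 k r c1 (s1 (th1 y))) 0 m =
     f (s1 (th1 y)) * (velocity c1 s1 (th1 y) *m g1 c1 (s1 (th1 y))) 0 m.
    by rewrite -scalemxAr mxE.
  have dh1 : derive1 h1 (th1 y) =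
      \sum_a partial f c1 (s1 (th1 y)) a * velocity c1 s1 (th1 y) 0 a.
    rewrite derive1E.
    by have [_ ->] := is_derive_along mfd1 oJ s1S J1 ct1 (df ct1).
  rewrite th1'' // dh1 partial_inv // /h1 -/(f (s1 (th1 y))).
  field.
  by rewrite f_neq0 k_neq0.
rewrite /= big1 => [|a _]; last by rewrite partial0 mul0r.
rewrite mul0r addr0 mulN1r.
rewrite (velocity_reparam s2S KJ2 th2S Ky ct2).
rewrite (acceleration_reparam mfd2 s2S oK KJ2 th2S Ky ct2).
rewrite lowered_acc_reparam.
have [c1' ct1'] := mfd_cover mfd1 (s1 (th2 y)).
have [_ acc2] := warped_accelerations J2 geo2 ct1' ct2.
have dh2 : derive1 h2 (th2 y) =
    - (dk_along c1' (th2 y) / k (s1 (th2 y)) ^+ 2).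
  have [_ E] := is_deriveV (k_neq0 (s1 (th2 y))) (is_derive_k J2 ct1').
  by rewrite derive1E [LHS]E scaleNr /GRing.scale /= mulrC.
rewrite acc2 th2'' // dh2 /h2; field.
exact: k_neq0.
Qed.

End Maupertuis.

(** * Geodesics of the warped product are Riemannian *)

Lemma interval_margin (R : realType) (J : set R) : open J -> is_interval J ->
  unit_itv `<=` J -> exists a b : R, [/\ a < 0, 1 < b & `[a, b] `<=` J].
Proof.
move=> oJ iJ IJ.
have J0 : J 0 by apply/IJ/unit_itvE; rewrite lexx ler01.
have J1 : J 1 by apply/IJ/unit_itvE; rewrite lexx ler01.
have /nbhs_ballP[e /= e0 eJ] : nbhs (0 : R) J by exact: open_nbhs_nbhs.
have /nbhs_ballP[d /= d0 dJ] : nbhs (1 : R) J by exact: open_nbhs_nbhs.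
exists (- (e / 2)), (1 + d / 2); split; [lra|lra|move=> t].
rewrite /= in_itv /= => /andP[at_ tb].
have Ja : J (- (e / 2)).
  by apply: eJ; rewrite /ball /= sub0r opprK ger0_norm; lra.
have Jb : J (1 + d / 2).
  apply: dJ; rewrite /ball /= opprD addrA subrr sub0r normrN ger0_norm; lra.
by apply: (iJ _ _ Ja Jb); rewrite at_ tb.
Qed.

Theorem theorem3p3 (R : realType) (n1 n2 : nat) (M1 M2 : topologicalType)
  (A1 : atlas R n1 M1) (A2 : atlas R n2 M2)
  (mfd1 : smooth_manifold A1) (mfd2 : smooth_manifold A2)
  (conn1 : connected [set: M1]) (conn2 : connected [set: M2])
  (g1 : metric A1) (g2 : metric A2)
  (riem1 : riemannian g1) (riem2 : riemannian g2)
  (compl1 : complete_metric g1) (compl2 : complete_metric g2)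
  (k : M1 -> R) (k_smooth : smooth_function A1 k)
  (k0_gt0 : 0 < inf (range k)) (k_bounded : has_ubound (range k))
  (gamma : R -> M1) (tau : R -> M2)
  (geod : geodesic (warped_metric g1 k g2) unit_itv
            (fun t => (gamma t, tau t)))
  (x0 : M1) (gamma0 : gamma 0 = x0)
  (c1 : chart A1) (X : 'rV[R]_n1) (velX : has_velocity gamma 0 c1 X)
  (c2 : chart A2) (Y : 'rV[R]_n2) (velY : has_velocity tau 0 c2 Y)
  (Y_neq0 : Y != 0)
  (hX : let K0 := sup (range k) in
        metric_at g1 c1 x0 X X >
        k x0 * metric_at g2 c2 (tau 0) Y Y * ((K0 - k x0) / K0)) :
  riemannian_geodesic g1 g2 k gamma tau.
Proof.
have [J [s [oJ iJ IJ sS sE]]] := geod.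
have k_inf : has_inf (range k).
  by apply: contrapT => /inf_out k_inf; move: k0_gt0; rewrite k_inf ltxx.
have k_gt0 p : 0 < k p.
  by apply: lt_le_trans k0_gt0 _; apply: ge_inf; [exact: k_inf.2|exists p].
set K0 := sup (range k) in hX *.
have kK0 p : k p <= K0 by apply: ub_le_sup => //; exists p.
have K0_gt0 : 0 < K0 by exact: lt_le_trans (k_gt0 x0) (kK0 x0).
(* [s1] and [s2] are smooth around the unit interval, where they agree with
   [gamma] and [tau]. *)
pose s1 := fst \o s; pose s2 := snd \o s.
have s1S : smooth_curve A1 J s1 by exact: (smooth_curve_fst mfd1 mfd2).
have s2S : smooth_curve A2 J s2 by exact: (smooth_curve_snd mfd1 mfd2).
have s1E t : unit_itv t -> gamma t = s1 t by move=> /sE[st _]; rewrite /s1 /= st.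
have s2E t : unit_itv t -> tau t = s2 t by move=> /sE[st _]; rewrite /s2 /= st.
have geo t : unit_itv t ->
    geodesic_eq (warped_metric g1 k g2) (fun t => (s1 t, s2 t)) t.
  move=> /sE[_]; suff -> : s = (fun t => (s1 t, s2 t)) by [].
  by apply/funext => u; rewrite /s1 /s2 /=; case: (s u).
have u0 : @unit_itv R 0 by apply/unit_itvE; rewrite lexx ler01.
have J0 := IJ _ u0.
pose e1 := sq_speed mfd1 s1 g1; pose e2 := sq_speed mfd2 s2 g2.
have momentum t : unit_itv t -> k (s1 t) ^+ 2 * e2 t = k (s1 0) ^+ 2 * e2 0.
  apply: (derive0_unit_itv (F := fun t => k (s1 t) ^+ 2 * e2 t)) => u Iu.
  exact: (is_derive_momentum mfd1 mfd2 riem1 riem2 k_smooth k_gt0 oJ s1S s2S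
    (IJ _ Iu) (geo _ Iu)).
have energy t : unit_itv t -> e1 t - k (s1 t) * e2 t = e1 0 - k (s1 0) * e2 0.
  apply: (derive0_unit_itv (F := fun t => e1 t - k (s1 t) * e2 t)) => u Iu.
  exact: (is_derive_energy mfd1 mfd2 riem1 riem2 k_smooth k_gt0 oJ s1S s2S
    (IJ _ Iu) (geo _ Iu)).
have [ct1 vX] := velX; have [ct2 vY] := velY.
have s10 : s1 0 = x0 by rewrite -s1E.
have s20 : s2 0 = tau 0 by rewrite -s2E.
have e10 : e1 0 = metric_at g1 c1 x0 X X.
  rewrite s1E // in ct1; rewrite /e1 (sq_speedE mfd1 oJ s1S riem1 J0 ct1) s10.
  suff -> : velocity c1 s1 0 = X by [].
  apply: derivative_within_unique vX; last by move=> t /s1E /= ->.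
  by rewrite /velocity derive1E; apply/derivableP/(derivable_chart s1S).
have e20 : e2 0 = metric_at g2 c2 (tau 0) Y Y.
  rewrite s2E // in ct2; rewrite /e2 (sq_speedE mfd2 oJ s2S riem2 J0 ct2) s20.
  suff -> : velocity c2 s2 0 = Y by [].
  apply: derivative_within_unique vY; last by move=> t /s2E /= ->.
  by rewrite /velocity derive1E; apply/derivableP/(derivable_chart s2S).
have e20_gt0 : 0 < e2 0 by rewrite e20; apply: (riem_pos riem2).
pose C := k x0 ^+ 2 * e2 0.
have C_gt0 : 0 < C by rewrite mulr_gt0 // exprn_gt0.
pose r := (e1 0 - k x0 * e2 0) / C.
(* The hypothesis on the initial velocities says exactly that the ratio of
   the energy to the squared momentum exceeds - 1 / K0. *)
have r_gt : - K0^-1 < r.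
  rewrite /r ltr_pdivlMr // -subr_gt0.
  have -> : e1 0 - k x0 * e2 0 - - K0^-1 * C =
      e1 0 - k x0 * e2 0 * ((K0 - k x0) / K0).
    by rewrite /C; field; rewrite gt_eqF.
  by rewrite subr_gt0 e10 e20.
have f_gt0 p : 0 < (k p)^-1 + r.
  have : K0^-1 <= (k p)^-1 by rewrite lef_pV2 ?posrE.
  by move: r_gt; lra.
have e2E t : unit_itv t -> k (s1 t) ^+ 2 * e2 t = C.
  by move=> /momentum ->; rewrite s10.
have e1E t : unit_itv t -> e1 t = C * ((k (s1 t))^-1 + r).
  move=> It; have kt : k (s1 t) != 0 by rewrite gt_eqF.
  have Ck : C * (k (s1 t))^-1 = k (s1 t) * e2 t.
    by rewrite -(e2E t It) expr2 mulrAC mulfK.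
  have Cr : C * r = e1 0 - k x0 * e2 0.
    by rewrite /r mulrC divfK // gt_eqF.
  rewrite mulrDr Ck Cr -{1}s10 -(energy t It) addrC.
  by rewrite subrK.
pose h1 t := (k (s1 t))^-1 + r; pose h2 t := (k (s1 t))^-1.
have h2S m : mderivable m J h2.
  apply: mderivableV => // [t _|]; first by rewrite gt_eqF.
  exact: (mderivable_along mfd1 oJ s1S).
have h1S m : mderivable m J h1 by apply: mderivableD => //; exact: mderivable_cst.
have h1_gt0 t : J t -> 0 < h1 t by move=> _; exact: f_gt0.
have h2_gt0 t : J t -> 0 < h2 t by move=> _; rewrite invr_gt0.
have [a [b [a0 b1 abJ]]] := interval_margin oJ iJ IJ.
have [l1 [ph [th1 [K1 [[l1_gt0 _ int1 ph_diffeo [ph0 ph1]]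
  [[dph phK th1I] [[oK1 iK1 IK1 K1J th1S] th1E]]]]]]] :=
  normalized_primitive oJ abJ a0 b1 h1S h1_gt0.
have [l2 [ps [th2 [K2 [[l2_gt0 int2 _ ps_diffeo [ps0 ps1]]
  [[dps psK th2I] [[oK2 iK2 IK2 K2J th2S] th2E]]]]]]] :=
  normalized_primitive oJ abJ a0 b1 h2S h2_gt0.
pose K := K1 `&` K2.
have oK : open K by exact: openI.
have KJ1 y : K y -> J (th1 y) by move=> [/K1J].
have KJ2 y : K y -> J (th2 y) by move=> [_ /K2J].
have th1S' m : mderivable m K th1 by apply: sub_mderivable (th1S m) => y [].
have th2S' m : mderivable m K th2 by apply: sub_mderivable (th2S m) => y [].
exists r, (s1 \o th1), (s2 \o th2); split; [exact: r_gt| | |exact: geod].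
- exists K, (fun y => (s1 (th1 y), s2 (th2 y))); split=> //.
  + move=> x y [x1 x2] [y1 y2] z xzy.
    by split; [exact: iK1 x1 y1 _ xzy|exact: iK2 x2 y2 _ xzy].
  + by move=> y Iy; split; [exact: IK1|exact: IK2].
  + exact: (smooth_curve_pair mfd1 mfd2 oK
      (smooth_curve_reparam mfd1 oJ s1S oK KJ1 th1S')
      (smooth_curve_reparam mfd2 oJ s2S oK KJ2 th2S')).
  + move=> y Iy; split=> //; have Ky : K y by split; [exact: IK1|exact: IK2].
    apply: (geodesic_eq_jacobi riem1 riem2 k_smooth k_gt0 oJ s1S s2S f_gt0 oK
      KJ1 KJ2 th1S' th2S' _ _ Ky (C := C)).
    * by move=> z [/th1E].
    * by move=> z [_ /th2E].
    * move=> t tE; have It : unit_itv t.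
        by case: tE => ->; [exact: th1I|exact: th2I].
      by split; [exact: geo|exact: e2E|exact: e1E].
- rewrite /reparametrized_from.
  have -> : \int[lebesgue_measure]_(xi in unit_itv)
      (k ((s1 \o th1) xi) / (1 + r * k ((s1 \o th1) xi))) = l1^-1.
    rewrite -int1; congr (Rintegral _ _ _); apply/funext => y /=.
    have kn0 : k (s1 (th1 y)) != 0 by rewrite gt_eqF.
    rewrite /h1 -[X in _ / (X + _)](mulVf kn0) -mulrDl invfM mulrCA.
    by rewrite mulfV // mulr1.
  have -> : \int[lebesgue_measure]_(xi in unit_itv) (k (gamma xi))^-1 = l2.
    by rewrite -int2; apply: eq_Rintegral => t; rewrite inE => /s1E ->.
  exists ph, ps; split; split=> //.
  + move=> t It; have [_ tK] := phK t It.
    apply: (is_derive_within (f := ph)) => //.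
    apply: is_derive_eq (dph t It) _; rewrite /= tK /h1.
    have kn0 : k (s1 t) != 0 by rewrite gt_eqF.
    by field; rewrite kn0 gt_eqF.
  + by move=> t It; have [_ tK] := phK t It; rewrite /= tK s1E.
  + move=> t It; apply: (is_derive_within (f := ps)) => //.
    by apply: is_derive_eq (dps t It) _; rewrite /h2 s1E // mulrC.
  + by move=> t It; have [_ tK] := psK t It; rewrite /= tK s2E.
Qed.
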